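(* Let $p\ge 2$ be an even integer, $\epsilon > 0$, $M$ a closed geodesic subset of $U_n$ equipped with the restriction of the metric $d_{p,\epsilon}$, and $A \subseteq M$ an arbitrary subset. If $\mathrm{radius}_{p,\epsilon}(A) < \pi/2$, then $A$ has a unique circumcenter in $(M, d_{p,\epsilon})$.
   Context: $U_n$ is the unitary group, $\mathfrak{u}_n$ the skew-Hermitian matrices, $\|x\|_q=\mathrm{Tr}(|x|^q)^{1/q}$ for $2\le q<\infty$, $\|x\|_\infty$ the operator norm. $d_q(u,v)$ ($q\in[2,\infty]$) is the infimum of $\int\|\dot\alpha(t)\|_q\,dt$ over piecewise smooth curves in $U_n$ joining $u$ and $v$; $d_{p,\epsilon}=(d_p^p+\epsilon^pd_2^2)^{1/p}$. For $d_\infty(u,v)<\pi$, $\gamma_{u,v}(t)=u\exp(t\log(u^{-1}v))$, $t\in[0,1]$, where $\log(w)$ is the unique $y\in\mathfrak{u}_n$ with $\|y\|_\infty<\pi$, $e^y=w$. A geodesic subset is a set $M\subseteq U_n$ any two points of which are joined by a piecewise smooth path in $M$ and such that $\gamma_{u,v}\subseteq M$ whenever $u,v\in M$ and $d_\infty(u,v)<\pi$. For a metric space $(M,d)$ and $A\subseteq M$: $\mathrm{radius}(A)=\inf\{r:\exists c\in M,\ A\subseteq B[c,r]\}$ with $B[c,r]$ the closed ball; a circumcenter of $A$ is a $c\in M$ with $\sup_{a\in A}d(c,a)=\mathrm{radius}(A)$. $\mathrm{radius}_{p,\epsilon}$ is the radius with respect to $d_{p,\epsilon}$. *)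

(* Defs.v *)
From mathcomp Require Import all_boot all_order all_algebra.
From mathcomp Require Import all_classical all_reals all_analysis.
From mathcomp Require Import complex.
Import Order.TTheory GRing.Theory Num.Theory.
Import numFieldNormedType.Exports.
Set Implicit Arguments.
Unset Strict Implicit.
Unset Printing Implicit Defensive.
Local Open Scope ring_scope.
Local Open Scope classical_set_scope.

Section UnitaryGeometry.
Variables (R : realType) (n : nat).
Local Notation C := R[i].
Local Notation mx := 'M[C]_n.

Definition adj (x : mx) : mx := (map_mx (@conjc R) x)^T.

Definition unitary : set mx := [set u | adj u *m u = 1%:M].
Definition skew_herm : set mx := [set y | adj y = - y].

Definition vnorm (v : 'cV[C]_n) : R :=
  Num.sqrt (\sum_(i < n) (complex.Re (v i 0) ^+ 2 + complex.Im (v i 0) ^+ 2)).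

Definition opnorm (x : mx) : R :=
  sup [set vnorm (x *m v) | v in [set v : 'cV[C]_n | vnorm v = 1]].

(* Schatten norm ||x||_p = Tr(|x|^p)^(1/p) for an EVEN integer p:
   here |x|^p = (x^* x)^(p/2). *)
Definition schatten_even (p : nat) (x : mx) : R :=
  powR (complex.Re (\tr ((adj x *m x) ^+ p./2))) (p%:R^-1).

Definition smooth (f : R -> R) : Prop :=
  forall (k : nat) (x : R), derivable (derive1n k f) x 1.

Definition smooth_mx (beta : R -> mx) : Prop :=
  forall i j, smooth (fun s => complex.Re (beta s i j)) /\
              smooth (fun s => complex.Im (beta s i j)).

Definition mderiv (beta : R -> mx) (t : R) : mx :=
  \matrix_(i, j) Complex (derive1 (fun s => complex.Re (beta s i j)) t)
                         (derive1 (fun s => complex.Im (beta s i j)) t).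

(* The set of lengths  int_a^b N(alpha'(t)) dt  of piecewise smooth curves
   alpha : [a,b] -> S from u to v.  The curve is split at a = t_0 < ... < t_k = b,
   and on each [t_i, t_{i+1}] it coincides with a smooth curve beta_i. *)
Definition path_lengths (N : mx -> R) (S : set mx) (u v : mx) : set R :=
  [set L | exists (a b : R) (alpha : R -> mx) (k : nat) (t : nat -> R)
                  (beta : nat -> R -> mx),
     t 0%N = a /\ t k = b /\ (forall i, (i < k)%N -> t i < t i.+1) /\
     alpha a = u /\ alpha b = v /\
     (forall s, a <= s <= b -> S (alpha s)) /\
     (forall i, (i < k)%N -> smooth_mx (beta i) /\
          forall s, t i <= s <= t i.+1 -> alpha s = beta i s) /\
     L = \sum_(i < k)
           Rintegral (@lebesgue_measure R) `[t i, t i.+1]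
                     (fun s => N (mderiv (beta i) s))].

Definition path_dist (N : mx -> R) (u v : mx) : R :=
  inf (path_lengths N unitary u v).

Definition d_inf := path_dist opnorm.
Definition d_even (p : nat) := path_dist (schatten_even p).

Definition d_peps (p : nat) (eps : R) (u v : mx) : R :=
  powR (d_even p u v ^+ p + eps ^+ p * d_even 2 u v ^+ 2) (p%:R^-1).

Definition exp_partial (y : mx) (N : nat) : mx :=
  \sum_(k < N) ((k`!)%:R : C)^-1 *: y ^+ k.
Definition expm (y : mx) : mx :=
  \matrix_(i, j) Complex (limn (fun N => complex.Re (exp_partial y N i j)))
                         (limn (fun N => complex.Im (exp_partial y N i j))).

Definition is_log (w y : mx) : Prop :=
  skew_herm y /\ opnorm y < pi /\ expm y = w.

Definition geodesic_subset (M : set mx) : Prop :=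
  [/\ M `<=` unitary,
      (forall u v, M u -> M v -> exists L, path_lengths opnorm M u v L) &
      (forall u v, M u -> M v -> d_inf u v < pi ->
         forall y, is_log (invmx u *m v) y ->
         forall t : R, 0 <= t <= 1 -> M (u *m expm (Complex t 0 *: y)))].

(* identification of complex matrices with pairs of real matrices (for topology) *)
Definition realify (x : mx) : 'M[R]_n * 'M[R]_n :=
  (map_mx (@complex.Re R) x, map_mx (@complex.Im R) x).

Definition mradius (d : mx -> mx -> R) (M A : set mx) : \bar R :=
  ereal_inf [set r%:E | r in
    [set r : R | exists c, M c /\ forall a, A a -> d c a <= r]].

Definition circumcenter (d : mx -> mx -> R) (M A : set mx) (c : mx) : Prop :=
  M c /\ ereal_sup [set (d c a)%:E | a in A] = mradius d M A.

End UnitaryGeometry.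

Arguments adj {R n}. Arguments unitary {R n}. Arguments skew_herm {R n}.
Arguments vnorm {R n}. Arguments opnorm {R n}. Arguments schatten_even {R n}.
Arguments smooth_mx {R n}. Arguments mderiv {R n}. Arguments path_lengths {R n}.
Arguments path_dist {R n}. Arguments d_inf {R n}. Arguments d_even {R n}.
Arguments d_peps {R n}. Arguments exp_partial {R n}. Arguments expm {R n}.
Arguments is_log {R n}. Arguments geodesic_subset {R n}. Arguments realify {R n}.
Arguments mradius {R n}. Arguments circumcenter {R n}.

(* Main.v *)
Require Import Defs.
From mathcomp Require Import all_boot all_order all_algebra.
From mathcomp Require Import all_classical all_reals all_analysis.
From mathcomp Require Import complex.
From mathcomp Require Import ring lra.
Import Order.TTheory GRing.Theory Num.Theory.
Import numFieldNormedType.Exports.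
Local Open Scope ring_scope.
Local Open Scope classical_set_scope.

Set Implicit Arguments.
Unset Strict Implicit.
Unset Printing Implicit Defensive.

(* For a unitary u = P^* diag(e^(i th_j)) P with angles in [-pi, pi], put
   F_p(u) = sum_j th_j^p.  Given eigenbases of two unitaries u, v with angles
   th_j, psi_k, the squared moduli s_jk of the change of basis are doubly
   stochastic and (P u^* v P^* )_jj = sum_k s_jk e^(i (psi_k - th_j)); hence any
   scalar inequality in sin(psi_k - th_j) and cos(psi_k - th_j) becomes an
   inequality between F_p(u) and F_p(v).

   The upper bound psi^p <= th^p + p th^(p-1) sin(psi - th) + K (1 - cos(psi - th))
   bounds the growth of F_p along a curve by Hoelder's inequality and pinching,
   so one-parameter subgroups are minimal and d_p(u, v)^p = F_p(u^* v).

   The lower bound psi^p >= th^p + p th^(p-1) sin(psi - th), valid for angles in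
   [-pi/2, pi/2], gives convexity at a midpoint m = u w of u and v = m w:
   u = m w^*, and the diagonal imaginary parts of w and w^* cancel.  For p = 2 it
   has the quadratic gain (1 - 2 rho / pi) (psi - th)^2 when |th| <= rho.  So two
   almost-centers of A are close to each other, which yields uniqueness, and
   existence as the limit of a minimizing sequence. *)

(** Sines and cosines appear because the eigenbases of u and v are unrelated: matrix entries are
    linear in the eigenvalues exp (i psi_k), so only trigonometric functions of the angles average
    to computable quantities. The upper bound also survives the jump of the logarithm at -1, and
    since it is an estimate between two points with quadratic error, no eigenvalue or eigenvector is
    ever differentiated along a curve. The term weighted by eps supplies the uniform convexity: for
    p > 2 the function th^p is flat at 0, so F_p alone has no gain proportional to (psi - th)^2. The
    bound pi/2 on the radius enters twice: it keeps the spectra of the translated points in the open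
    right half-plane, so that two almost-centers are joined by a short geodesic whose midpoint stays
    in that range, and it makes 1 - 2 rho / pi positive. *)

Section Scalar.
Variable R : realType.
Implicit Types (x y t s d rho : R) (k p : nat).

(** Convexity of the power in the one form that later yields Jensen, Young, the tangent bound for
    even powers and the Euler step of [root_growth]. *)
Lemma tangent_exprn x y k : 0 <= x -> 0 <= y ->
  k%:R * y ^+ k.-1 * (x - y) <= x ^+ k - y ^+ k.
Proof.
move=> x0 y0; elim: k => [|k IH]; first by rewrite !expr0 subrr !mul0r.
have -> : x ^+ k.+1 - y ^+ k.+1 = x * (x ^+ k - y ^+ k) + y ^+ k * (x - y).
  by rewrite !exprS; ring.
have h : k%:R * y ^+ k * (x - y) <= x * (k%:R * y ^+ k.-1 * (x - y)).
  case: k {IH} => [|k]; first by rewrite !mul0r mulr0.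
  rewrite -subr_ge0 [X in 0 <= X](_ : _ = k.+1%:R * y ^+ k * (x - y) ^+ 2).
    by rewrite mulr_ge0 ?sqr_ge0 ?mulr_ge0 ?exprn_ge0.
  by rewrite /= exprS; ring.
have := ler_wpM2l x0 IH; rewrite /= -natr1 => h2.
by rewrite mulrDl mul1r mulrDl lerD// (le_trans h).
Qed.

Lemma taylor2_exprn (B : R) k : 0 <= B -> exists2 K : R, 0 <= K &
  forall t d, `|t| <= B -> `|d| <= B ->
    `|(t + d) ^+ k - t ^+ k - k%:R * t ^+ k.-1 * d| <= K * d ^+ 2.
Proof.
move=> B0; elim: k => [|k [K K0 IH]].
  by exists 0 => // t d _ _; rewrite !expr0 !mul0r subrr subr0 normr0.
exists ((B + B) * K + k%:R * B ^+ k.-1) => [|t d tB dB].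
  by rewrite addr_ge0 ?mulr_ge0 ?addr_ge0 ?exprn_ge0.
have -> : (t + d) ^+ k.+1 - t ^+ k.+1 - k.+1%:R * t ^+ k.+1.-1 * d =
   (t + d) * ((t + d) ^+ k - t ^+ k - k%:R * t ^+ k.-1 * d)
   + k%:R * t ^+ k.-1 * d ^+ 2.
  case: k {IH} => [|k]; first by rewrite !expr0 !expr1; ring.
  by rewrite /= -(natr1 k.+1) !exprS; ring.
apply: (le_trans (ler_normD _ _)); rewrite [leRHS]mulrDl lerD//.
  rewrite normrM -[leRHS]mulrA ler_pM// ?IH//.
  by rewrite (le_trans (ler_normD _ _))// lerD.
rewrite normrM normrX real_normK ?num_real// ler_wpM2r ?sqr_ge0//.
by rewrite normrM normr_nat normrX ler_wpM2l// lerXn2r// nnegrE.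
Qed.

(** * Trigonometric inequalities for a single pair of angles *)

Lemma derive_ge0_le (f df : R -> R) a b : a <= b ->
  (forall x, is_derive x 1 f (df x)) ->
  (forall x, a <= x <= b -> 0 <= df x) -> f a <= f b.
Proof.
move=> ab Df df0; have cf : continuous f.
  by move=> x; apply/differentiable_continuous/derivable1_diffP; case: (Df x).
have [|c] := @MVT_segment _ f df a b ab (fun x _ => Df x).
  exact: continuous_subspaceT.
rewrite in_itv/= => cab fE; rewrite -subr_ge0 fE mulr_ge0 ?subr_ge0//.
exact: df0.
Qed.

Lemma sin_le x : 0 <= x -> sin x <= x.
Proof.
move=> x0.
have /(_ x x0) h := @derive_ge0_le (fun x => x - sin x) (fun x => 1 - cos x) 0.
rewrite sin0 subr0 subr_ge0 in h; apply: h => y _.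
by rewrite subr_ge0 cos_le1.
Qed.

Lemma abs_sin_le x : `|sin x| <= `|x|.
Proof.
wlog x0 : x / 0 <= x => [H|].
  by have [/H//|/ltW] := leP 0 x; rewrite -oppr_ge0 => /H; rewrite sinN !normrN.
rewrite (ger0_norm x0) ler_norml sin_le// andbT.
have /(_ x x0) h := @derive_ge0_le (fun x => x + sin x) (fun x => 1 + cos x) 0.
rewrite sin0 addr0 -lerBlDl sub0r lerNl in h.
rewrite lerNl; apply: h => y _.
by rewrite -lerBlDl sub0r cos_geN1.
Qed.

Lemma onem_cosE x : 1 - cos x = 2 * sin (x / 2) ^+ 2.
Proof.
have -> : cos x = cos ((x / 2) *+ 2) by congr cos; rewrite -mulr_natr; field.
rewrite cos_mulr2n cos2sin2 -mulr_natr; ring.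
Qed.

Lemma onem_cos_le x : 1 - cos x <= x ^+ 2 / 2.
Proof.
rewrite onem_cosE; have : `|sin (x / 2)| ^+ 2 <= `|x / 2| ^+ 2.
  by rewrite lerXn2r ?nnegrE// abs_sin_le.
rewrite !real_normK ?num_real// expr_div_n => h; lra.
Qed.

Lemma cos_le (a b : R) : 0 <= a -> a <= b -> b <= pi -> cos b <= cos a.
Proof.
move=> a0 ab bp; have [->//|ne] := eqVneq a b.
rewrite ltW// ltr_cos ?in_itv/= ?a0 ?bp ?andbT ?(le_trans a0)//.
  by rewrite lt_neqAle ne.
by rewrite (le_trans ab).
Qed.

(* [sin y - 2 y / pi] increases and then decreases. *)
Lemma jordan x : 0 <= x <= pi / 2 -> 2 * x / pi <= sin x.
Proof.
move=> /andP[x0 xpi].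
have p0 := @pi_gt0 R; have p2 := @pi_ge2 R.
pose c : R := 2 / pi.
have c01 : -1 <= c <= 1.
  by rewrite /c; apply/andP; split; [rewrite (@le_trans _ _ 0)// ?divr_ge0 // ltW|
    rewrite ler_pdivrMr// mul1r].
pose y := acos c; have cy : cos y = c by rewrite acosK// in_itv.
have y0 : 0 <= y by rewrite acos_ge0.
have ypi : y <= pi by rewrite acos_lepi.
have D (z : R) : is_derive z (1:R) (fun z : R => sin z - c * z) (cos z - c).
  by apply: is_derive_eq; rewrite !scaler1.
have Dn (z : R) : is_derive z (1:R) (fun z : R => - (sin z - c * z)) (- (cos z - c)).
  exact: is_deriveN.
rewrite mulrAC -/c -subr_ge0; have [xy|yx] := leP x y.
  have := derive_ge0_le x0 D; rewrite sin0 mulr0 subrr; apply => z /andP[z0 zx].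
  by rewrite subr_ge0 -cy cos_le// (le_trans zx).
have cpi : c * (pi / 2) = 1 by rewrite /c mulrA divfK ?divff// gt_eqF.
have := derive_ge0_le xpi Dn; rewrite sin_pihalf cpi subrr oppr0 oppr_le0.
apply => z /andP[xz zp].
rewrite oppr_ge0 subr_le0 -cy cos_le//; first exact: (le_trans (ltW yx)).
by rewrite (le_trans zp)// ler_pdivrMr//; lra.
Qed.

(** Both sides are symmetric about pi/2. On [0, pi/2] the derivative of their difference at z is
    nonnegative by Jordan's inequality at pi/2 - z. *)
Lemma sin_ge_parabola x : 0 <= x <= pi -> x * (pi - x) / pi <= sin x.
Proof.
have p0 := @pi_gt0 R; have pn0 : pi != 0 :> R by rewrite gt_eqF.
wlog xpi : x / x <= pi / 2 => [H /andP[x0 xp]|/andP[x0 _]].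
  have [h|h] := leP x (pi / 2); first by apply: H => //; rewrite x0.
  have := H (pi - x); rewrite subKr sinB sinpi cospi mul0r sub0r mulN1r opprK.
  by rewrite (mulrC _ x); apply; lra.
have D (z : R) : is_derive z (1:R) (fun z : R => sin z - z * (pi - z) / pi)
    (cos z - (1 - 2 * z / pi)).
  apply: is_derive_eq; rewrite !scaler1 ?scaler0 ?add0r.
  rewrite -[LHS]/(cos z - pi^-1 * (z * (1 * -1) + (pi - z))).
  by move: (@pi R) pn0 => q qn0; field.
have := derive_ge0_le x0 D; rewrite sin0 !mul0r subrr subr_ge0.
apply => z /andP[z0 zx]; rewrite subr_ge0.
have -> : cos z = sin (pi / 2 - z).
  by rewrite sinB sin_pihalf cos_pihalf mul1r mul0r subr0.
apply: le_trans (@jordan _ _); last lra.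
by rewrite le_eqVlt; apply/orP; left; apply/eqP; move: (@pi R) pn0 => q qn0; field.
Qed.

(** The parabola bound rearranged. The constant 1/pi, attained at d = pi, is the source of the
    factor 1 - 2 rho / pi. *)
Lemma sin_defect_le d : `|d| <= pi -> `|d - sin d| <= d ^+ 2 / pi.
Proof.
have p0 := @pi_gt0 R; have pn0 : pi != 0 :> R by rewrite gt_eqF.
wlog d0 : d / 0 <= d => [H|].
  have [/H//|/ltW] := leP 0 d; rewrite -oppr_ge0 => /H.
  by rewrite sinN !normrN sqrrN -opprD normrN.
rewrite (ger0_norm d0) => dpi; rewrite ger0_norm ?subr_ge0 ?sin_le//.
rewrite lerBlDl -lerBlDr; apply: le_trans (sin_ge_parabola _); last by rewrite d0.
by rewrite le_eqVlt; apply/orP; left; apply/eqP; move: (@pi R) pn0 => q qn0; field.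
Qed.

Lemma onem_cos_ge d : `|d| <= pi -> d ^+ 2 / 8 <= 1 - cos d.
Proof.
have p0 := @pi_gt0 R; have pn0 : pi != 0 :> R by rewrite gt_eqF.
move=> dpi; rewrite -cos_norm -(real_normK (num_real d)).
move: (normr_ge0 d) dpi; set e := `|d| => e0 epi.
have h : e / 4 <= sin (e / 2).
  apply: le_trans (sin_ge_parabola _); last lra.
  rewrite ler_pdivlMr//; nra.
rewrite onem_cosE; have : (e / 4) ^+ 2 <= sin (e / 2) ^+ 2.
  by rewrite lerXn2r// nnegrE ?(le_trans _ h)// divr_ge0.
rewrite expr_div_n => h2; lra.
Qed.

(** With d = s - t, s^2 - t^2 - 2 t sin d = d^2 + 2 t (d - sin d), and the sine defect costs at most
    2 rho d^2 / pi. *)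
Lemma tangent_sqr_ge rho t s : `|t| <= rho -> `|s - t| <= pi ->
  t ^+ 2 + 2 * t * sin (s - t) + (1 - 2 * rho / pi) * (s - t) ^+ 2 <= s ^+ 2.
Proof.
have p0 := @pi_gt0 R; have pn0 : pi != 0 :> R by rewrite gt_eqF.
move=> tr /sin_defect_le; set d := s - t.
have -> : s = t + d by rewrite /d addrC subrK.
move=> h; have : `|t * (d - sin d)| <= rho * (d ^+ 2 / pi).
  by rewrite normrM ler_pM.
rewrite ler_norml => /andP[h1 _].
have -> : (1 - 2 * rho / pi) * d ^+ 2 = d ^+ 2 - 2 * (rho * (d ^+ 2 / pi)).
  by move: (@pi R) pn0 => q qn0; field.
by move: h1; set z := rho * _ => h1; nra.
Qed.

(** Write the even power as a power of the square: convexity in the variable t^2 reduces the claim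
    to [tangent_sqr_ge] with rho = pi/2, where the gain vanishes. *)
Lemma tangent_exprn_ge p t s : ~~ odd p ->
  `|t| <= pi / 2 -> `|s| <= pi / 2 ->
  t ^+ p + p%:R * t ^+ p.-1 * sin (s - t) <= s ^+ p.
Proof.
move=> op tp sp; have p0 := @pi_gt0 R.
have -> : p = (p./2).*2 by rewrite even_halfK.
case: p./2 => [|m] {op}; first by rewrite !expr0 mul0r mul0r addr0.
have E x : x ^+ m.+1.*2 = (x ^+ 2) ^+ m.+1 by rewrite -exprM mul2n.
rewrite !E {E}.
have := @tangent_exprn (s ^+ 2) (t ^+ 2) m.+1 (sqr_ge0 _) (sqr_ge0 _).
rewrite /= lerBrDl; apply: le_trans; rewrite lerD2l.
have -> : m.+1.*2%:R * t ^+ m.*2.+1 * sin (s - t) =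
   m.+1%:R * (t ^+ 2) ^+ m * (2 * t * sin (s - t)).
  rewrite -exprM mul2n -muln2 natrM exprS; ring.
rewrite ler_wpM2l//.
  by rewrite mulr_ge0// exprn_ge0// sqr_ge0.
rewrite lerBrDl; apply: le_trans (@tangent_sqr_ge (pi / 2) t s tp _).
  rewrite (_ : 1 - _ = 0) ?mul0r ?addr0//.
  by rewrite (mulrC 2) divfK// divff ?subrr// gt_eqF.
apply: (le_trans (ler_normB _ _)); lra.
Qed.

Lemma semiconcave_exprn p : ~~ odd p -> exists2 K : R, 0 <= K &
  forall t s, `|t| <= pi -> `|s| <= pi ->
  s ^+ p <= t ^+ p + p%:R * t ^+ p.-1 * sin (s - t) + K * (1 - cos (s - t)).
Proof.
move=> op; have p0 := @pi_gt0 R.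
have [K K0 hK] := @taylor2_exprn pi p (ltW p0).
pose B : R := p%:R * pi ^+ p.-1.
(* The Taylor remainder K d^2 and the cost B d^2 / pi of replacing d by sin d become multiples of 1
   - cos d through d^2 <= 8 (1 - cos d). *)
exists (8 * (K + B / pi)).
  by rewrite mulr_ge0// addr_ge0// divr_ge0 ?mulr_ge0 ?exprn_ge0// ltW.
have main t d : `|t| <= pi -> `|d| <= pi ->
  (t + d) ^+ p <= t ^+ p + p%:R * t ^+ p.-1 * sin d + 8 * (K + B / pi) * (1 - cos d).
  move=> tp dp; have := hK t d tp dp; rewrite ler_norml => /andP[_].
  have h2 := sin_defect_le dp; have h3 := onem_cos_ge dp.
  have : `|p%:R * t ^+ p.-1 * (d - sin d)| <= B * (d ^+ 2 / pi).
    rewrite normrM ler_pM// normrM normr_nat ler_wpM2l// normrX lerXn2r ?nnegrE//.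
    exact: ltW.
  rewrite ler_norml => /andP[_]; rewrite mulrBr.
  have : (K + B / pi) * (d ^+ 2 / 8) <= (K + B / pi) * (1 - cos d).
    by rewrite ler_wpM2l// addr_ge0// divr_ge0 ?mulr_ge0 ?exprn_ge0// ltW.
  rewrite (_ : B * (d ^+ 2 / pi) = B / pi * d ^+ 2); last by rewrite mulrCA mulrC.
  move: (B / pi) => b; nra.
have even_le x y : `|x| <= `|y| -> x ^+ p <= y ^+ p.
  move=> xy; rewrite -(ger0_norm (exprn_even_ge0 x op)).
  by rewrite -(ger0_norm (exprn_even_ge0 y op)) !normrX lerXn2r ?nnegrE.
move=> t s; rewrite !ler_norml => /andP[t1 t2] /andP[s1 s2].
have tp : `|t| <= pi by rewrite ler_norml t1.
(* When s and t lie on opposite sides of the cut, shift s by 2 pi towards t: sine and cosine of the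
   difference are unchanged, the new difference is in [-pi, pi], and the even power of s can only
   grow because |s| <= pi. *)
have [h|h] := leP (s - t) pi; last first.
  have := main t (s - t - pi *+ 2) tp.
  rewrite -(sinD2pi (s - t - pi *+ 2)) -(cosD2pi (s - t - pi *+ 2)) subrK.
  move=> H; apply: le_trans (H _); last by rewrite ler_norml mulr2n; lra.
  apply: even_le; rewrite mulr2n (_ : t + _ = s - 2 * pi); last by ring.
  by rewrite [leRHS]ler0_norm ?ler_norml; lra.
have [h2|h2] := leP (- pi) (s - t).
  have := main t (s - t) tp; rewrite (_ : t + (s - t) = s); last by ring.
  by apply; rewrite ler_norml h2.
have := main t (s - t + pi *+ 2) tp.
rewrite sinD2pi cosD2pi.
move=> H; apply: le_trans (H _); last by rewrite ler_norml mulr2n; lra.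
apply: even_le; rewrite mulr2n (_ : t + _ = s + 2 * pi); last by ring.
by rewrite [leRHS]ger0_norm ?ler_norml; lra.
Qed.

End Scalar.

(** * Jensen and Hoelder inequalities with integer exponents *)

Section FiniteSums.
Variable R : realType.

(** Average the tangent lines at the mean [mu]: their linear parts cancel. *)
Lemma jensen_exprn (I : finType) (w l : I -> R) m :
  (forall i, 0 <= w i) -> \sum_i w i = 1 -> (forall i, 0 <= l i) ->
  (\sum_i w i * l i) ^+ m <= \sum_i w i * l i ^+ m.
Proof.
move=> w0 w1 l0; set mu := \sum_i _.
have mu0 : 0 <= mu by apply: sumr_ge0 => i _; rewrite mulr_ge0.
have -> : mu ^+ m = \sum_i w i * (mu ^+ m + m%:R * mu ^+ m.-1 * (l i - mu)).
  under eq_bigr do rewrite mulrDr mulrCA mulrBr.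
  rewrite big_split/= -mulr_suml w1 mul1r -mulr_sumr sumrB -/mu -mulr_suml w1.
  by rewrite mul1r subrr mulr0 addr0.
apply: ler_sum => i _; rewrite ler_wpM2l// -lerBrDl.
exact: tangent_exprn.
Qed.

(** Upper bounds X and Y replace the norms, so no roots occur. Normalizing divides by X and Y, hence
    the separate treatment of zero. *)
Lemma hoelder_sum (I : finType) (a b : I -> R) (X Y : R) p : (1 < p)%N ->
  (forall i, 0 <= a i) -> (forall i, 0 <= b i) -> 0 <= X -> 0 <= Y ->
  \sum_i a i ^+ p <= X ^+ p -> \sum_i b i ^+ p <= Y ^+ p ->
  \sum_i a i ^+ p.-1 * b i <= X ^+ p.-1 * Y.
Proof.
move=> p1 a0 b0 X0 Y0 aX bY.
have pn0 : p != 0%N by case: p p1 {aX bY}.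
have null (c : I -> R) (Z : R) : (forall i, 0 <= c i) -> \sum_i c i ^+ p <= Z ^+ p ->
    Z = 0 -> forall i, c i = 0.
  move=> c0 cZ Z0 i; move: cZ; rewrite Z0 expr0n (negbTE pn0) => cZ.
  have s0 : \sum_i c i ^+ p = 0.
    by apply/eqP; rewrite eq_le cZ sumr_ge0// => j _; rewrite exprn_ge0.
  have := psumr_eq0P (fun i (_ : xpredT i) => exprn_ge0 p (c0 i)) s0.
  by move=> /(_ i isT)/eqP; rewrite expf_eq0 => /andP[_ /eqP].
have [X00|Xn0] := eqVneq X 0.
  rewrite big1 ?mulr_ge0 ?exprn_ge0// => i _.
  rewrite (null a X)// expr0n; case: p p1 {aX bY pn0 null} => [|[]]// p _.
  by rewrite mul0r.
have [Y00|Yn0] := eqVneq Y 0.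
  by rewrite big1 ?mulr_ge0 ?exprn_ge0// => i _; rewrite (null b Y)// mulr0.
have Xp : 0 < X by rewrite lt_neqAle eq_sym Xn0.
have Yp : 0 < Y by rewrite lt_neqAle eq_sym Yn0.
(* Young's inequality is the tangent of the p-th power at a/X, evaluated at b/Y. *)
have young i : p%:R * ((a i / X) ^+ p.-1 * (b i / Y)) <=
    (b i / Y) ^+ p + (p%:R - 1) * (a i / X) ^+ p.
  have ha : 0 <= a i / X by rewrite divr_ge0.
  have hb : 0 <= b i / Y by rewrite divr_ge0.
  have := tangent_exprn p hb ha.
  have -> : (a i / X) ^+ p = (a i / X) * (a i / X) ^+ p.-1.
    by rewrite -exprS prednK// (ltn_trans _ p1).
  move: (_ ^+ p.-1) => z; move: (_ ^+ p) => y; move: (a i / X) => x; nra.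
have sum1 (c : I -> R) (Z : R) : 0 < Z -> \sum_i c i ^+ p <= Z ^+ p ->
    \sum_i (c i / Z) ^+ p <= 1.
  move=> Z0 cZ; under eq_bigr do rewrite expr_div_n.
  by rewrite -mulr_suml ler_pdivrMr ?exprn_gt0// mul1r.
have : \sum_i p%:R * ((a i / X) ^+ p.-1 * (b i / Y)) <= p%:R * 1.
  apply: (le_trans (ler_sum _ (fun i _ => young i))).
  rewrite big_split/= -mulr_sumr.
  have : (p%:R - 1) * \sum_i (a i / X) ^+ p <= (p%:R - 1) * 1.
    by rewrite ler_wpM2l ?sum1// subr_ge0 ler1n ltnW.
  by have := sum1 b Y Yp bY; lra.
rewrite -mulr_sumr ler_pM2l ?ltr0n ?lt0n//.
under eq_bigr do rewrite expr_div_n mulf_div.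
by rewrite -mulr_suml ler_pdivrMr ?mul1r// mulr_gt0// exprn_gt0.
Qed.

End FiniteSums.

(** * Complex numbers by real and imaginary parts, and the unit circle *)

Section Complex.
Variable R : realType.
Local Notation C := R[i].
Implicit Types (z w : C) (s t : R).

Definition normsq z : R := complex.Re z ^+ 2 + complex.Im z ^+ 2.

Definition expi t : C := Complex (cos t) (sin t).

Lemma Re_addc z w : complex.Re (z + w) = complex.Re z + complex.Re w.
Proof. by case: z; case: w. Qed.

Lemma Im_addc z w : complex.Im (z + w) = complex.Im z + complex.Im w.
Proof. by case: z; case: w. Qed.

Lemma Re_oppc z : complex.Re (- z) = - complex.Re z.
Proof. by case: z. Qed.

Lemma Im_oppc z : complex.Im (- z) = - complex.Im z.
Proof. by case: z. Qed.

Lemma Re_mulc z w :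
  complex.Re (z * w) = complex.Re z * complex.Re w - complex.Im z * complex.Im w.
Proof. by case: z; case: w. Qed.

Lemma Im_mulc z w :
  complex.Im (z * w) = complex.Re z * complex.Im w + complex.Im z * complex.Re w.
Proof. by case: z; case: w. Qed.

Lemma Re_conjc z : complex.Re (conjc z) = complex.Re z.
Proof. by case: z. Qed.

Lemma Im_conjc z : complex.Im (conjc z) = - complex.Im z.
Proof. by case: z. Qed.

Lemma Re_sum (I : Type) (r : seq I) (P : pred I) (F : I -> C) :
  complex.Re (\sum_(i <- r | P i) F i) = \sum_(i <- r | P i) complex.Re (F i).
Proof. exact: (big_morph _ Re_addc). Qed.

Lemma Im_sum (I : Type) (r : seq I) (P : pred I) (F : I -> C) :
  complex.Im (\sum_(i <- r | P i) F i) = \sum_(i <- r | P i) complex.Im (F i).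
Proof. exact: (big_morph _ Im_addc). Qed.

Lemma complex_inj z w : complex.Re z = complex.Re w ->
  complex.Im z = complex.Im w -> z = w.
Proof. by case: z => a b; case: w => c d /= -> ->. Qed.

Lemma normsq_ge0 z : 0 <= normsq z.
Proof. by rewrite addr_ge0 ?sqr_ge0. Qed.

Lemma normsqE z : Complex (normsq z) 0 = conjc z * z.
Proof.
by apply: complex_inj; rewrite ?Re_mulc ?Im_mulc Re_conjc Im_conjc /normsq /=; ring.
Qed.

Lemma normsq_conjc z : normsq (conjc z) = normsq z.
Proof. by rewrite /normsq Re_conjc Im_conjc sqrrN. Qed.

Lemma normsqM z w : normsq (z * w) = normsq z * normsq w.
Proof. by rewrite /normsq Re_mulc Im_mulc; ring. Qed.

Lemma expi0 : expi 0 = 1.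
Proof. by rewrite /expi cos0 sin0. Qed.

Lemma expiD s t : expi (s + t) = expi s * expi t.
Proof. by apply: complex_inj; rewrite ?Re_mulc ?Im_mulc /= ?cosD ?sinD; ring. Qed.

Lemma conjc_expi t : conjc (expi t) = expi (- t).
Proof. by rewrite /expi /= cosN sinN. Qed.

Lemma normsq_expi t : normsq (expi t) = 1.
Proof. exact: cos2Dsin2. Qed.

Lemma expi_surj z : normsq z = 1 -> exists2 t, `|t| <= pi & z = expi t.
Proof.
case: z => a b; rewrite /normsq /= => ab.
have ha : -1 <= a <= 1 by nra.
have ca : cos (acos a) = a by rewrite acosK// in_itv.
have h0 := acos_ge0 ha; have h1 := acos_lepi ha.
have sa : sin (acos a) = Num.sqrt (1 - a ^+ 2) by rewrite sin_acos.
have b2 : 1 - a ^+ 2 = b ^+ 2 by lra.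
have [b0|b0] := leP 0 b.
  exists (acos a); first by rewrite ger0_norm.
  by apply: complex_inj; rewrite /= ?ca ?sa// b2 sqrtr_sqr ger0_norm.
exists (- acos a); first by rewrite normrN ger0_norm.
apply: complex_inj; rewrite /= ?cosN ?sinN ?ca ?sa// b2 sqrtr_sqr ltr0_norm//.
by rewrite opprK.
Qed.

End Complex.

(** * Unitary diagonalization, diagonal entries in a second basis, and pinching *)

Section LinearAlgebra.
Variables (R : realType) (n : nat).
Local Notation C := R[i].
Local Notation mx := 'M[C]_n.
Implicit Types (x y u v P Q : mx) (d e : 'I_n -> C) (a : R).

Definition dg Q x (k : 'I_n) : C := (Q *m x *m adj Q) k k.

Definition sdec P d : mx := adj P *m diag_mx (\row_j d j) *m P.

Definition wt Q P (k l : 'I_n) : R := normsq ((Q *m adj P) k l).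

(** The square of the Frobenius norm, not the norm itself. *)
Definition frob x : R := \sum_i \sum_j normsq (x i j).

Lemma adjE x i j : adj x i j = conjc (x j i).
Proof. by rewrite !mxE. Qed.

Lemma adjM x y : adj (x *m y) = adj y *m adj x.
Proof. by rewrite /adj map_mxM trmx_mul. Qed.

Lemma adjK x : adj (adj x) = x.
Proof. by apply/matrixP => i j; rewrite !adjE conjcK. Qed.

Lemma adjD x y : adj (x + y) = adj x + adj y.
Proof. by apply/matrixP => i j; rewrite !(adjE, mxE) rmorphD. Qed.

Lemma adjN x : adj (- x) = - adj x.
Proof. by apply/matrixP => i j; rewrite !(adjE, mxE) rmorphN. Qed.

Lemma adj1 : adj (1%:M : mx) = 1%:M.
Proof.
by apply/matrixP => i j; rewrite !(adjE, mxE) eq_sym; case: (_ == _);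
  rewrite ?conjc1 ?conjc0.
Qed.

Lemma unitaryVr u : unitary u -> u *m adj u = 1%:M.
Proof. exact: mulmx1C. Qed.

Lemma unitary1 : unitary (1%:M : mx).
Proof. by rewrite /unitary/= adj1 mulmx1. Qed.

Lemma unitary_adj u : unitary u -> unitary (adj u).
Proof. by move=> uu; rewrite /unitary/= adjK unitaryVr. Qed.

Lemma unitary_mul u v : unitary u -> unitary v -> unitary (u *m v).
Proof.
move=> uu vv; rewrite /unitary/= adjM mulmxA -(mulmxA (adj v)).
by rewrite uu mulmx1.
Qed.

Lemma invmx_unitary u : unitary u -> invmx u = adj u.
Proof.
move=> uu; have uV := unitaryVr uu.
have uU : u \in unitmx by case: (mulmx1_unit uV).
by rewrite -[LHS]mulmx1 -uV mulKmx.
Qed.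

Lemma adj_t x : adj x = map_mx Num.conj (x^T).
Proof. by apply/matrixP => i j; rewrite adjE !mxE. Qed.

Lemma spectral_sdec x : x *m adj x = adj x *m x ->
  exists P d, unitary P /\ x = sdec P d.
Proof.
move=> xx; have /orthomx_spectralP E : x \is normalmx.
  by apply/normalmxP; rewrite -adj_t.
have PU := spectral_unitarymx x.
exists (spectralmx x), (fun j => spectral_diag x 0 j); split.
  by apply: mulmx1C; apply/eqP; move: PU; rewrite qualifE adj_t.
rewrite {1}E /sdec invmx_unitary -?adj_t; last first.
  by apply: mulmx1C; apply/eqP; move: PU; rewrite qualifE adj_t.
congr (_ *m diag_mx _ *m _); apply/rowP => j; by rewrite mxE.
Qed.

Lemma adj_sdec P d : adj (sdec P d) = sdec P (fun j => conjc (d j)).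
Proof.
rewrite /sdec !adjM adjK mulmxA; congr (_ *m _ *m _).
apply/matrixP => i j; rewrite adjE !mxE eq_sym.
by have [->|] := eqVneq i j; rewrite ?mulr1n ?mulr0n ?conjc0.
Qed.

Lemma sdecM P d e : unitary P ->
  sdec P d *m sdec P e = sdec P (fun j => d j * e j).
Proof.
move=> /unitaryVr PP; rewrite /sdec !mulmxA -(mulmxA _ P (adj P)) PP mulmx1.
congr (_ *m _); rewrite -!mulmxA mulmx_diag; congr (_ *m diag_mx _).
by apply/rowP => j; rewrite !mxE.
Qed.

Lemma sdec1 P : unitary P -> sdec P (fun=> 1) = 1%:M.
Proof.
move=> PP; rewrite /sdec (_ : diag_mx _ = 1%:M) ?mulmx1//.
by apply/matrixP => i j; rewrite !mxE.
Qed.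

Lemma sdecD P d e : sdec P d + sdec P e = sdec P (fun j => d j + e j).
Proof.
rewrite /sdec -mulmxDl -mulmxDr -raddfD; congr (_ *m diag_mx _ *m _).
by apply/rowP => j; rewrite !mxE.
Qed.

Lemma sdecX P d k : unitary P -> sdec P d ^+ k = sdec P (fun j => d j ^+ k).
Proof.
move=> PP; elim: k => [|k IH]; first exact/esym/sdec1.
rewrite exprS IH -[_ * _]/(_ *m _) sdecM//; congr sdec.
by apply/funext => j; rewrite exprS.
Qed.

Lemma sdecZ P d c : c *: sdec P d = sdec P (fun j => c * d j).
Proof.
rewrite /sdec -!mulmxA scalemxAr scalemxAl; congr (_ *m (_ *m _)).
by apply/matrixP => i j; rewrite !mxE mulrnAr.
Qed.

Lemma unitary_sdec P d : unitary P -> (forall j, normsq (d j) = 1) ->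
  unitary (sdec P d).
Proof.
move=> PP d1; rewrite /unitary/= adj_sdec sdecM// -(sdec1 PP); congr sdec.
by apply/funext => j; rewrite -normsqE d1.
Qed.

Lemma dg_sdec Q P d k : dg Q (sdec P d) k =
  \sum_l Complex (wt Q P k l) 0 * d l.
Proof.
rewrite /dg /sdec !mulmxA -(mulmxA _ P).
rewrite mxE; apply: eq_bigr => l _; rewrite mul_mx_diag !mxE.
have -> : (\sum_j P l j * adj Q j k) = conjc ((Q *m adj P) k l).
  by rewrite -adjE adjM adjK mxE.
by rewrite /wt normsqE mxE; ring.
Qed.

Lemma wt_ge0 Q P k l : 0 <= wt Q P k l. Proof. exact: normsq_ge0. Qed.

Lemma wt_sumr Q P k : unitary Q -> unitary P -> \sum_l wt Q P k l = 1.
Proof.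
move=> QQ PP; have := dg_sdec Q P (fun=> 1) k.
rewrite sdec1// /dg mulmx1 unitaryVr// mxE eqxx => /(congr1 (@complex.Re R)).
move=> h; rewrite -[RHS]/(complex.Re (true%:R : C)) h Re_sum.
by apply: eq_bigr => l _; rewrite mulr1.
Qed.

Lemma wtC Q P k l : wt Q P k l = wt P Q l k.
Proof.
rewrite /wt -normsq_conjc -adjE adjM adjK.
by [].
Qed.

Lemma wt_suml Q P l : unitary Q -> unitary P -> \sum_k wt Q P k l = 1.
Proof. by move=> QQ PP; under eq_bigr do rewrite wtC; exact: wt_sumr. Qed.

Lemma Re_dg_sdec Q P d k :
  complex.Re (dg Q (sdec P d) k) = \sum_l wt Q P k l * complex.Re (d l).
Proof.
by rewrite dg_sdec Re_sum; apply: eq_bigr => l _; rewrite Re_mulc /= mul0r subr0.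
Qed.

Lemma Im_dg_sdec Q P d k :
  complex.Im (dg Q (sdec P d) k) = \sum_l wt Q P k l * complex.Im (d l).
Proof.
by rewrite dg_sdec Im_sum; apply: eq_bigr => l _; rewrite Im_mulc /= mul0r addr0.
Qed.

Lemma dgD Q x y k : dg Q (x + y) k = dg Q x k + dg Q y k.
Proof. by rewrite /dg mulmxDr mulmxDl mxE. Qed.

Lemma dgN Q x k : dg Q (- x) k = - dg Q x k.
Proof. by rewrite /dg mulmxN mulNmx [LHS]mxE. Qed.

Lemma dg_adj Q x k : dg Q (adj x) k = conjc (dg Q x k).
Proof. by rewrite /dg -adjE !adjM adjK mulmxA. Qed.

Lemma dg_mull Q d y k : unitary Q -> dg Q (sdec Q d *m y) k = d k * dg Q y k.
Proof.
move=> /unitaryVr QQ; rewrite /dg /sdec !mulmxA QQ mul1mx -!mulmxA.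
by rewrite mul_diag_mx !mxE.
Qed.

Lemma dg_mulr Q d y k : unitary Q -> dg Q (y *m sdec Q d) k = dg Q y k * d k.
Proof.
move=> /unitaryVr QQ; rewrite /dg /sdec -!mulmxA QQ mulmx1 !mulmxA.
by rewrite mul_mx_diag !mxE.
Qed.

Lemma sum_dg Q x : unitary Q -> \sum_k dg Q x k = \tr x.
Proof. by move=> QQ; rewrite -/(mxtrace _) mxtrace_mulC mulmxA QQ mul1mx. Qed.

Lemma tr_sdec P d : unitary P -> \tr (sdec P d) = \sum_j d j.
Proof.
move=> PP; rewrite -(sum_dg _ PP); apply: eq_bigr => k _.
by rewrite -[sdec P d]mulmx1 dg_mull// /dg mulmx1 unitaryVr// mxE eqxx mulr1.
Qed.

Lemma frob_tr x : frob x = complex.Re (\tr (adj x *m x)).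
Proof.
rewrite /frob exchange_big /mxtrace Re_sum; apply: eq_bigr => j _.
rewrite mxE Re_sum; apply: eq_bigr => i _.
by rewrite adjE -normsqE.
Qed.

Lemma frob_ge0 x : 0 <= frob x.
Proof. by apply: sumr_ge0 => i _; apply: sumr_ge0 => j _; exact: normsq_ge0. Qed.

Lemma normsq_le_frob x i j : normsq (x i j) <= frob x.
Proof.
rewrite /frob (bigD1 i)//= (bigD1 j)//= -addrA lerDl addr_ge0//.
  by apply: sumr_ge0 => k _; exact: normsq_ge0.
by apply: sumr_ge0 => k _; apply: sumr_ge0 => l _; exact: normsq_ge0.
Qed.

(** Identifies the averaged [1 - cos] term of [spectral_transfer] with half a squared distance;
    every later factor 1/2 in front of [frob] comes from here. *)
Lemma frobB_unitary u v : unitary u -> unitary v ->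
  frob (u - v) = 2 * (n%:R - complex.Re (\tr (adj u *m v))).
Proof.
move=> uu vv; rewrite frob_tr adjD adjN mulmxDl !mulmxDr !mulNmx !mulmxN opprK.
rewrite uu vv !mxtraceD !(raddfN (@mxtrace C n)) !mxtrace1 !Re_addc !Re_oppc.
have -> : complex.Re (\tr (adj v *m u)) = complex.Re (\tr (adj u *m v)).
  rewrite -[adj v *m u]adjK adjM adjK /mxtrace !Re_sum; apply: eq_bigr => i _.
  by rewrite adjE Re_conjc.
have -> : complex.Re (n%:R : C) = n%:R.
  by elim: n => [//|m IH]; rewrite -!natr1 Re_addc IH.
ring.
Qed.

(* The weights [wt P Q j k] are doubly stochastic and
   [(P u^* v P^* )_jj = sum_k wt P Q j k * exp (i (psi_k - th_j))], so a scalar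
   inequality involving only [sin] and [cos] of [psi_k - th_j] sums up to an
   inequality about [u] and [v]. *)
Lemma spectral_transfer u v P Q (th psi : 'I_n -> R) (A B b : 'I_n -> R) (c : R) :
  unitary P -> unitary Q ->
  u = sdec P (fun j => expi (th j)) -> v = sdec Q (fun j => expi (psi j)) ->
  (forall j k, A k <= B j + b j * sin (psi k - th j)
                      + c * (1 - cos (psi k - th j))) ->
  \sum_k A k <= \sum_j B j + \sum_j b j * complex.Im (dg P (adj u *m v) j)
                + c * (n%:R - complex.Re (\tr (adj u *m v))).
Proof.
move=> PP QQ uE vE H.
have dgE j : dg P (adj u *m v) j = dg P (sdec Q (fun k => expi (psi k - th j))) j.
  rewrite uE adj_sdec dg_mull// vE !dg_sdec mulr_sumr; apply: eq_bigr => k _.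
  by rewrite conjc_expi mulrCA -expiD addrC.
have -> : \sum_k A k = \sum_j \sum_k wt P Q j k * A k.
  rewrite exchange_big; apply: eq_bigr => k _.
  by rewrite -mulr_suml wt_suml// mul1r.
have -> : n%:R - complex.Re (\tr (adj u *m v)) =
    \sum_j (1 - complex.Re (dg P (adj u *m v) j)).
  rewrite sumrB sumr_const card_ord -(sum_dg _ PP) Re_sum.
  by congr (_ - _).
rewrite mulr_sumr -!big_split/=; apply: ler_sum => j _.
rewrite dgE Im_dg_sdec Re_dg_sdec/=.
have -> : B j + b j * \sum_l wt P Q j l * sin (psi l - th j)
     + c * (1 - \sum_l wt P Q j l * cos (psi l - th j)) =
  \sum_l wt P Q j l * (B j + b j * sin (psi l - th j)
                      + c * (1 - cos (psi l - th j))).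
  rewrite -{1}[B j]mul1r -[X in c * (X - _)](wt_sumr j PP QQ).
  rewrite -(wt_sumr j PP QQ) -sumrB mulr_suml !mulr_sumr -!big_split/=.
  by apply: eq_bigr => l _; rewrite wt_sumr//; ring.
by apply: ler_sum => k _; rewrite ler_wpM2l ?wt_ge0.
Qed.

(** The j-th eigenvalue is the squared length of the j-th column of [x *m adj P], hence real and
    nonnegative. *)
Lemma gram_sdec x : exists P (l : 'I_n -> R), [/\ unitary P,
  (forall j, 0 <= l j) & adj x *m x = sdec P (fun j => Complex (l j) 0)].
Proof.
have [P [d [PP E]]] : exists P d, unitary P /\ adj x *m x = sdec P d.
  by apply: spectral_sdec; rewrite adjM adjK.
have dE j : d j = Complex (\sum_i normsq ((x *m adj P) i j)) 0.
  have -> : d j = dg P (adj x *m x) j.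
    by rewrite E -[sdec P d]mulmx1 dg_mull// /dg mulmx1 unitaryVr// mxE eqxx mulr1.
  rewrite /dg mulmxA -[P *m adj x]adjK adjM adjK -mulmxA mxE.
  apply: complex_inj; rewrite ?Re_sum ?Im_sum/=.
    by apply: eq_bigr => i _; rewrite adjE -normsqE.
  by rewrite big1// => i _; rewrite adjE -normsqE.
exists P, (fun j => \sum_i normsq ((x *m adj P) i j)); split => //.
  by move=> j; apply: sumr_ge0 => i _; exact: normsq_ge0.
by rewrite E; congr sdec; apply/funext.
Qed.

Lemma tr_gramX_ge0 x m : 0 <= complex.Re (\tr ((adj x *m x) ^+ m)).
Proof.
have [P [l [PP l0 ->]]] := gram_sdec x.
rewrite sdecX// tr_sdec// Re_sum; apply: sumr_ge0 => j _.
by rewrite -(rmorphXn (real_complex R)) exprn_ge0.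
Qed.

(** For y = Q x P^*, |y_kk|^2 <= (y^* y)_kk, which is a doubly stochastic average of the eigenvalues
    of x^* x; Jensen and the column sums conclude. The second unitary [Q] absorbs a left factor such
    as u^*. *)
Lemma pinching x P Q m : unitary P -> unitary Q ->
  \sum_j normsq ((Q *m x *m adj P) j j) ^+ m <=
  complex.Re (\tr ((adj x *m x) ^+ m)).
Proof.
move=> PP QQ; have [S [l [SS l0 E]]] := gram_sdec x.
rewrite E sdecX// tr_sdec// Re_sum.
have -> : \sum_j complex.Re (Complex (l j) 0 ^+ m) =
   \sum_k \sum_j wt P S k j * l j ^+ m.
  rewrite exchange_big; apply: eq_bigr => j _.
  by rewrite -(rmorphXn (real_complex R)) -mulr_suml wt_suml// mul1r.
apply: ler_sum => k _.
apply: le_trans (jensen_exprn _ _ _ _) => //; last 2 first.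
- by move=> j; exact: wt_ge0.
- exact: wt_sumr.
rewrite lerXn2r ?nnegrE ?normsq_ge0//.
  by apply: sumr_ge0 => j _; rewrite mulr_ge0 ?wt_ge0.
have -> : \sum_i wt P S k i * l i = complex.Re (dg P (adj x *m x) k).
  by rewrite E Re_dg_sdec.
have -> : dg P (adj x *m x) k = (adj (Q *m x *m adj P) *m (Q *m x *m adj P)) k k.
  rewrite /dg !adjM adjK !mulmxA; congr (fun_of_matrix (_ *m _) _ _).
  by rewrite -!mulmxA (mulmxA (adj Q)) QQ mul1mx.
move: (Q *m x *m adj P) => y; rewrite mxE Re_sum (bigD1 k)//= adjE -normsqE/= lerDl.
by apply: sumr_ge0 => i _; rewrite adjE -normsqE/= normsq_ge0.
Qed.

End LinearAlgebra.

(** * Real p-th roots, and growth of a function controlled through its p-th power *)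

Section Roots.
Variable R : realType.
Implicit Types (x y a b : R) (p : nat).

Lemma rootK p x : (0 < p)%N -> 0 <= x -> (x `^ p%:R^-1) ^+ p = x.
Proof.
move=> p0 x0; rewrite -powR_mulrn ?powR_ge0// -powRrM mulVf ?powRr1//.
by rewrite pnatr_eq0 -lt0n.
Qed.

Lemma exprnD_ge p a b : (0 < p)%N -> 0 <= a -> 0 <= b ->
  a ^+ p + b ^+ p <= (a + b) ^+ p.
Proof.
case: p => // p _ a0 b0; elim: p => [|p IH]; first by rewrite !expr1.
rewrite exprS (exprS b) (exprS (a + b)).
have h : (a + b) * (a ^+ p.+1 + b ^+ p.+1) <= (a + b) * (a + b) ^+ p.+1.
  by rewrite ler_wpM2l ?addr_ge0.
apply: le_trans h; have := exprn_ge0 p.+1 a0; have := exprn_ge0 p.+1 b0.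
move: (a ^+ p.+1) (b ^+ p.+1) => A B; nra.
Qed.

(** Superadditivity of the p-th power gives |u - v|^p <= |u^p - v^p|, so the root is continuous even
    at 0. *)
Lemma continuous_root p (h : R -> R) : (0 < p)%N -> (forall t, 0 <= h t) ->
  continuous h -> continuous (fun t => h t `^ p%:R^-1).
Proof.
move=> p0 h0 ch t; apply/cvgrPdist_lt => e e0.
have ep : 0 < e ^+ p by rewrite exprn_gt0.
have /cvgrPdist_lt/(_ _ ep) := ch t; apply: filterS => s.
set u := h t `^ _; set v := h s `^ _.
have -> : h t = u ^+ p by rewrite rootK.
have -> : h s = v ^+ p by rewrite rootK.
have : 0 <= u by exact: powR_ge0.
have : 0 <= v by exact: powR_ge0.
move: u v => u v.
wlog uv : u v / v <= u => [H v0 u0|v0 u0].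
  have [/H//|/ltW] := leP v u; first by apply.
  by rewrite distrC (distrC u) => /H; apply.
have d0 : 0 <= u - v by rewrite subr_ge0.
have := exprnD_ge p0 d0 v0; rewrite subrK -lerBrDr => h1 h2.
rewrite ger0_norm//; rewrite -(ltr_pXn2r p0) ?nnegrE// ?(ltW e0)//.
exact: le_lt_trans h1 (le_lt_trans (ler_norm _) h2).
Qed.

(* Euler discretisation of [(g^p)' <= p g^(p-1) S'], shifted by [eta > 0] to
   stay away from the zeros of [g]. *)
Lemma root_growth p (g S : R -> R) a b (K : R) : (0 < p)%N -> a <= b -> 0 <= K ->
  (forall t, 0 <= g t) ->
  (forall s t, a <= s -> s <= t -> t <= b -> S s <= S t) ->
  (forall s t, a <= s -> s <= t -> t <= b ->
    g t ^+ p <= g s ^+ p + p%:R * g s ^+ p.-1 * (S t - S s) + K * (t - s) ^+ 2) ->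
  g b <= g a + (S b - S a).
Proof.
move=> p0 ab K0 g0 mS H; apply/ler_addgt0Pr => e e0.
pose eta : R := e / 2; have eta0 : 0 < eta by rewrite divr_gt0.
(* Since the bound carried along stays above [eta], [c] is below the slope p Psi^(p-1). An error K
   h^2 in the p-th power thus costs at most K' h^2 in Psi, and [N] is chosen so that all N errors
   together stay below [eta]. *)
pose c := p%:R * eta ^+ p.-1.
have c0 : 0 < c by rewrite mulr_gt0 ?ltr0n// exprn_gt0.
pose K' := K / c; have K'0 : 0 <= K' by rewrite divr_ge0// ltW.
pose N := (Num.bound ((b - a) ^+ 2 * K' / eta)).+1.
have N0 : 0 < N%:R :> R by rewrite ltr0n.
have hN : (b - a) ^+ 2 * K' / N%:R <= eta.
  rewrite ler_pdivrMr// (mulrC eta) -ler_pdivrMr// ltW//.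
  have X0 : 0 <= (b - a) ^+ 2 * K' / eta.
    by apply: divr_ge0 (ltW _); first by apply: mulr_ge0 => //; exact: sqr_ge0.
  by apply: lt_le_trans (archi_boundP X0) _; rewrite ler_nat.
pose h := (b - a) / N%:R; have h0 : 0 <= h by rewrite divr_ge0 ?subr_ge0// ltW.
have tle k : (k <= N)%N -> a + k%:R * h <= b.
  move=> kN; rewrite -lerBrDl /h mulrA ler_pdivrMr// mulrC.
  by rewrite ler_wpM2l ?subr_ge0// ler_nat.
have claim k : (k <= N)%N ->
    g (a + k%:R * h) <= g a + eta + (S (a + k%:R * h) - S a) + k%:R * (K' * h ^+ 2).
  elim: k => [_|k IH kN].
    by rewrite !mul0r addr0 subrr !addr0 lerDl ltW.
  have {}IH := IH (ltnW kN).
  set s := a + k%:R * h in IH *; set t := a + k.+1%:R * h.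
  have as_ : a <= s by rewrite lerDl mulr_ge0.
  have st : s <= t by rewrite lerD2l ler_wpM2r// ler_nat.
  have tb : t <= b := tle _ kN.
  have ts : t - s = h by rewrite /t /s -natr1; ring.
  set Psi := g a + eta + _ + _ in IH.
  have SsSa : 0 <= S s - S a by rewrite subr_ge0 mS// (le_trans st).
  have dS : 0 <= S t - S s by rewrite subr_ge0 mS.
  have ePsi : eta <= Psi.
    rewrite /Psi -addrA [g a + _]addrC -addrA lerDl addr_ge0// addr_ge0//.
    by rewrite mulr_ge0// mulr_ge0// sqr_ge0.
  have Psi0 : 0 <= Psi by rewrite (le_trans _ ePsi)// ltW.
  have Kh0 : 0 <= K' * h ^+ 2 by rewrite mulr_ge0 ?sqr_ge0.
  have -> : g a + eta + (S t - S a) + k.+1%:R * (K' * h ^+ 2) =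
      Psi + (S t - S s + K' * h ^+ 2) by rewrite /Psi -natr1; ring.
  have X0 : 0 <= Psi + (S t - S s + K' * h ^+ 2).
    by apply: addr_ge0 => //; exact: addr_ge0.
  rewrite -(ler_pXn2r p0) ?nnegrE//.
  apply: le_trans (H _ _ as_ st tb) _; rewrite ts.
  have := tangent_exprn p X0 Psi0; rewrite [X in _ * X]addrC addKr lerBrDl.
  apply: le_trans.
  rewrite [X in _ <= _ + X]mulrDr [leRHS]addrA.
  apply: lerD; first apply: lerD.
  - by rewrite lerXn2r ?nnegrE.
  - by rewrite ler_wpM2r// ler_wpM2l// lerXn2r ?nnegrE.
  - rewrite mulrA ler_wpM2r ?sqr_ge0//.
    have -> : K = c * K' by rewrite /K' mulrCA divff ?mulr1 ?gt_eqF.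
    rewrite ler_wpM2r// ler_wpM2l// lerXn2r ?nnegrE//; exact: ltW.
have := claim N (leqnn _).
have -> : N%:R * h = b - a by rewrite /h mulrCA divff ?mulr1// gt_eqF.
have -> : a + (b - a) = b by ring.
have -> : N%:R * (K' * h ^+ 2) = (b - a) ^+ 2 * K' / N%:R.
  by rewrite /h expr_div_n; field; rewrite gt_eqF.
move=> h1; apply: (le_trans h1); rewrite /eta in hN *; lra.
Qed.

End Roots.

(** * Power sums of the eigenvalue angles of a unitary matrix *)

Section SpectralPower.
Variables (R : realType) (n : nat).
Local Notation C := R[i].
Local Notation mx := 'M[C]_n.
Implicit Types (x y u v P Q : mx) (th psi : 'I_n -> R) (p : nat).

Definition angdec u P th := [/\ unitary P, (forall j, `|th j| <= pi) &
  u = sdec P (fun j => expi (th j))].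

(* [spow p u] is Tr |log u|^p, with eigenvalue angles in [-pi, pi]. *)
Definition spow p u : R :=
  xget 0 [set r | exists P th, angdec u P th /\ r = \sum_j th j ^+ p].

Lemma unitary_angdec u : unitary u -> exists P th, angdec u P th.
Proof.
move=> uu; have [P [d [PP uE]]] : exists P d, unitary P /\ u = sdec P d.
  by apply: spectral_sdec; rewrite uu unitaryVr.
have d1 j : normsq (d j) = 1.
  have E : (fun k => conjc (d k) * d k) = (fun k => Complex (normsq (d k)) 0).
    by apply/funext => k; rewrite normsqE.
  have := dg_mull (fun k => Complex (normsq (d k)) 0) 1%:M j PP.
  rewrite mulmx1 -E -sdecM// -adj_sdec -uE uu /dg mulmx1 unitaryVr// mxE eqxx mulr1.
  by case.
have /choice[th thP] j : exists t, `|t| <= pi /\ d j = expi t.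
  by have [t ? ?] := expi_surj (d1 j); exists t.
exists P, th; split => // [j|]; first by case: (thP j).
by rewrite uE; congr sdec; apply/funext => j; case: (thP j).
Qed.

Lemma angdec_unitary u P th : angdec u P th -> unitary u.
Proof.
by move=> [PP _ ->]; apply: unitary_sdec => // j; rewrite normsq_expi.
Qed.

Lemma angdec_semiconcave p : ~~ odd p -> exists2 K : R, 0 <= K &
  forall u v P Q th psi, angdec u P th -> angdec v Q psi ->
  \sum_j psi j ^+ p <= \sum_j th j ^+ p
    + \sum_j p%:R * th j ^+ p.-1 * complex.Im (dg P (adj u *m v) j)
    + K * frob (u - v).
Proof.
move=> op; have [K K0 HK] := semiconcave_exprn R op.
(* Halved because [frob (u - v)] is twice the averaged [1 - cos] term. *)
exists (K / 2) => [|u v P Q th psi du dv]; first by rewrite divr_ge0.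
have uu := angdec_unitary du; have vv := angdec_unitary dv.
case: du dv => [PP thpi uE] [QQ psipi vE].
rewrite frobB_unitary// mulrA divfK ?pnatr_eq0//.
by apply: (spectral_transfer PP QQ uE vE) => j k; exact: HK.
Qed.

Lemma dgI_unitary P u j : unitary P -> unitary u -> dg P (adj u *m u) j = 1.
Proof. by move=> PP uu; rewrite uu /dg mulmx1 unitaryVr// mxE eqxx. Qed.

(** Independence of the decomposition, including the choice between -pi and pi: for v = u the
    first-order and error terms of [angdec_semiconcave] vanish, and exchanging the two
    decompositions gives equality. *)
Lemma spowE p u P th : ~~ odd p -> angdec u P th -> spow p u = \sum_j th j ^+ p.
Proof.
move=> op du; have [K _ HK] := angdec_semiconcave op.
have uu := angdec_unitary du.
have wd Q psi Q' psi' : angdec u Q psi -> angdec u Q' psi' ->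
    \sum_j psi' j ^+ p <= \sum_j psi j ^+ p.
  move=> d1 d2; have := HK _ _ _ _ _ _ d1 d2; rewrite subrr.
  have -> : frob (0 : mx) = 0.
    rewrite /frob big1// => i _; rewrite big1// => j _.
    by rewrite mxE /normsq /= expr0n addr0.
  rewrite mulr0 addr0 [X in _ + X]big1 ?addr0// => j _.
  by case: (d1) => QQ _ _; rewrite dgI_unitary//= mulr0.
rewrite /spow; case: xgetP => [r _ [Q [psi [dQ ->]]]|/(_ (\sum_j th j ^+ p))[]].
  by apply/eqP; rewrite eq_le (wd _ _ _ _ du dQ) (wd _ _ _ _ dQ du).
by exists P, th.
Qed.

Lemma spow_ge0 p u : ~~ odd p -> 0 <= spow p u.
Proof.
move=> op; rewrite /spow; case: xgetP => // r _ [P [th [_ ->]]].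
by apply: sumr_ge0 => j _; exact: exprn_even_ge0.
Qed.

Lemma angdec_adj u P th : angdec u P th -> angdec (adj u) P (fun j => - th j).
Proof.
move=> [PP thpi ->]; split => // [j|]; first by rewrite normrN.
by rewrite adj_sdec; congr sdec; apply/funext => j; rewrite conjc_expi.
Qed.

Lemma spow_adj p u : ~~ odd p -> unitary u -> spow p (adj u) = spow p u.
Proof.
move=> op /unitary_angdec[P [th du]].
rewrite (spowE op du) (spowE op (angdec_adj du)); apply: eq_bigr => j _.
by rewrite exprNn -signr_odd (negbTE op) mul1r.
Qed.

Lemma spow1 p : (0 < p)%N -> ~~ odd p -> spow p (1%:M : mx) = 0.
Proof.
move=> p0 op; rewrite (@spowE _ _ 1%:M (fun=> 0) op).
  by rewrite big1// => j _; rewrite expr0n eqn0Ngt p0.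
split => [|j|]; [exact: unitary1|by rewrite normr0 pi_ge0|].
by rewrite expi0 sdec1//; exact: unitary1.
Qed.

Lemma angle_le_spow p u P th j : ~~ odd p -> angdec u P th ->
  th j ^+ p <= spow p u.
Proof.
move=> op du; rewrite (spowE op du) (bigD1 j)//= lerDl.
by apply: sumr_ge0 => k _; exact: exprn_even_ge0.
Qed.

(** The first-order term of [angdec_semiconcave] vanishes at v = u, so it is governed by the
    diagonal of P u^* (u - v) P^*, which pinching with exponent 1 bounds by the Frobenius norm. This
    is the continuity used when passing to the limit of almost-centers. *)
Lemma spow_lip p : ~~ odd p -> exists2 K : R, 0 <= K &
  forall u v, unitary u -> unitary v ->
  spow p v <= spow p u + K * Num.sqrt (frob (u - v)) + K * frob (u - v).
Proof.
move=> op; have [K K0 HK] := angdec_semiconcave op.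
pose L : R := n%:R * (p%:R * pi ^+ p.-1).
have L0 : 0 <= L by rewrite !mulr_ge0// exprn_ge0// pi_ge0.
exists (K + L) => [|u v uu vv]; first exact: addr_ge0.
have [P [th du]] := unitary_angdec uu; have [Q [psi dv]] := unitary_angdec vv.
have f0 := frob_ge0 (u - v).
rewrite (spowE op du) (spowE op dv); apply: le_trans (HK _ _ _ _ _ _ du dv) _.
apply: lerD; last by rewrite ler_wpM2r// lerDl.
rewrite lerD2l.
apply: (@le_trans _ _ (L * Num.sqrt (frob (u - v)))); last first.
  by rewrite ler_wpM2r ?sqrtr_ge0// lerDr.
rewrite /L -mulrA -[X in X * _](_ : \sum_(j < n) 1 = _ :> R); last first.
  by rewrite sumr_const card_ord.
rewrite mulr_suml; apply: ler_sum => j _; rewrite mul1r.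
case: (du) => PP thpi uE.
have -> : complex.Im (dg P (adj u *m v) j) =
    - complex.Im ((P *m adj u *m (u - v) *m adj P) j j).
  have -> : P *m adj u *m (u - v) = P *m (adj u *m u - adj u *m v).
    by rewrite -mulmxA mulmxBr.
  rewrite -/(dg P _ j) dgD dgI_unitary// Im_addc /= add0r.
  by rewrite dgN Im_oppc opprK.
apply: le_trans (ler_norm _) _; rewrite normrM; apply: ler_pM => //.
  rewrite normrM normr_nat ler_wpM2l// normrX lerXn2r ?nnegrE//.
  exact: pi_ge0.
rewrite normrN -sqrtr_sqr ler_wsqrtr//.
have := pinching (u - v) 1 PP (unitary_mul PP (unitary_adj uu)).
under eq_bigr do rewrite expr1.
rewrite expr1 -frob_tr; apply: le_trans.
rewrite (bigD1 j)//= /normsq -addrA (addrC (_ ^+ 2)) -addrA lerDl addr_ge0//.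
  by apply: sumr_ge0 => k _; exact: normsq_ge0.
exact: sqr_ge0.
Qed.

End SpectralPower.

(** * Continuity and derivatives of complex-valued functions of a real variable *)

Section ComplexCurves.
Variable R : realType.
Local Notation C := R[i].
Implicit Types (f g df : R -> C).

Definition ccont f := continuous (fun t => complex.Re (f t)) /\
                      continuous (fun t => complex.Im (f t)).

Lemma ccont_cst (c : C) : ccont (fun=> c).
Proof. by split => t; exact: cvg_cst. Qed.

Lemma ccontD f g : ccont f -> ccont g -> ccont (fun t => f t + g t).
Proof.
move=> [fr fi] [gr gi]; split.
  by under eq_fun do rewrite Re_addc; move=> t; apply: cvgD; [exact: fr|exact: gr].
by under eq_fun do rewrite Im_addc; move=> t; apply: cvgD; [exact: fi|exact: gi].
Qed.

Lemma ccontM f g : ccont f -> ccont g -> ccont (fun t => f t * g t).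
Proof.
move=> [fr fi] [gr gi]; split.
  under eq_fun do rewrite Re_mulc; move=> t; apply: cvgB.
    by apply: cvgM; [exact: fr|exact: gr].
  by apply: cvgM; [exact: fi|exact: gi].
under eq_fun do rewrite Im_mulc; move=> t; apply: cvgD.
  by apply: cvgM; [exact: fr|exact: gi].
by apply: cvgM; [exact: fi|exact: gr].
Qed.

Lemma ccont_conjc f : ccont f -> ccont (fun t => conjc (f t)).
Proof.
move=> [fr fi]; split; first by under eq_fun do rewrite Re_conjc.
by under eq_fun do rewrite Im_conjc; move=> t; apply: cvgN; exact: fi.
Qed.

Lemma ccont_sum (I : Type) (r : seq I) (F : I -> R -> C) :
  (forall i, ccont (F i)) -> ccont (fun t => \sum_(i <- r) F i t).
Proof.
move=> cF; elim: r => [|i r IH].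
  by under eq_fun do rewrite big_nil; exact: ccont_cst.
by under eq_fun do rewrite big_cons; exact: ccontD.
Qed.

Definition cderiv f df := forall t,
  is_derive t (1 : R) (fun s => complex.Re (f s)) (complex.Re (df t)) /\
  is_derive t (1 : R) (fun s => complex.Im (f s)) (complex.Im (df t)).

Lemma eq_cderiv f g df dg : f =1 g -> df =1 dg -> cderiv f df -> cderiv g dg.
Proof. by move=> /funext -> /funext ->. Qed.

Lemma cderiv_cst (c : C) : cderiv (fun=> c) (fun=> 0).
Proof. by move=> t; split; exact: is_derive_cst. Qed.

Lemma cderivD f df g dg : cderiv f df -> cderiv g dg ->
  cderiv (fun t => f t + g t) (fun t => df t + dg t).
Proof.
move=> Hf Hg t; have [fr fi] := Hf t; have [gr gi] := Hg t; split.
  by under eq_fun do rewrite Re_addc; rewrite Re_addc; exact: is_deriveD.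
by under eq_fun do rewrite Im_addc; rewrite Im_addc; exact: is_deriveD.
Qed.

Lemma cderivM (c : C) f df : cderiv f df ->
  cderiv (fun t => c * f t) (fun t => c * df t).
Proof.
move=> Hf t; have [fr fi] := Hf t; split.
  under eq_fun do rewrite Re_mulc; rewrite Re_mulc.
  by apply: is_deriveB; exact: is_deriveZ.
under eq_fun do rewrite Im_mulc; rewrite Im_mulc.
by apply: is_deriveD; exact: is_deriveZ.
Qed.

Lemma cderiv_sum (I : Type) (r : seq I) (F dF : I -> R -> C) :
  (forall i, cderiv (F i) (dF i)) ->
  cderiv (fun t => \sum_(i <- r) F i t) (fun t => \sum_(i <- r) dF i t).
Proof.
move=> cF; elim: r => [|i r IH].
  by apply: eq_cderiv (cderiv_cst 0) => t; rewrite big_nil.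
by apply: eq_cderiv (cderivD (cF i) IH) => t; rewrite big_cons.
Qed.

End ComplexCurves.

(** * Regularity of smooth matrix curves and comparison with the integral of the speed *)

Section Speed.
Variables (R : realType) (n : nat).
Local Notation C := R[i].
Local Notation mx := 'M[C]_n.
Local Notation mu := (@lebesgue_measure R).
Implicit Types (beta : R -> mx) (p : nat).

Lemma smooth_derive (f : R -> R) : smooth f ->
  (forall t, is_derive t (1 : R) f (derive1 f t)) /\ continuous (derive1 f).
Proof.
move=> sf; split => t.
  by rewrite derive1E; apply: derivableP; exact: (sf 0%N).
by apply/differentiable_continuous/derivable1_diffP; exact: (sf 1%N).
Qed.

Lemma smooth_lip (f : R -> R) a b : smooth f -> exists2 K : R, 0 <= K &
  forall s t, a <= s -> s <= t -> t <= b -> (f s - f t) ^+ 2 <= K * (t - s) ^+ 2.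
Proof.
move=> /smooth_derive[Df cf].
have [ab|ba] := leP a b; last first.
  exists 0 => // s t as_ st tb.
  by have := lt_le_trans ba (le_trans as_ (le_trans st tb)); rewrite ltxx.
have [|c cab cmax] := @EVT_max R (fun t => derive1 f t ^+ 2) a b ab.
  apply: continuous_subspaceT => t; exact: (cvgM (cf t) (cf t)).
exists (derive1 f c ^+ 2) => [|s t as_ st tb]; first exact: sqr_ge0.
have cont : continuous f.
  by move=> x; apply/differentiable_continuous/derivable1_diffP; case: (Df x).
have [|d dst] := @MVT_segment _ f (derive1 f) s t st (fun x _ => Df x).
  exact: continuous_subspaceT.
rewrite -sqrrN opprB => ->; rewrite exprMn ler_wpM2r ?sqr_ge0//.
apply: cmax; move: dst; rewrite !in_itv/= => /andP[sd dt].
by rewrite (le_trans as_)// (le_trans dt).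
Qed.

(** As [frob] is a square, this Lipschitz bound is exactly the quadratic error that [root_growth]
    tolerates. *)
Lemma smooth_mx_lip beta a b : smooth_mx beta -> exists2 K : R, 0 <= K &
  forall s t, a <= s -> s <= t -> t <= b ->
    frob (beta s - beta t) <= K * (t - s) ^+ 2.
Proof.
move=> sb.
have H (ij : 'I_n * 'I_n) : exists K : R, 0 <= K /\
    forall s t, a <= s -> s <= t -> t <= b ->
    normsq ((beta s - beta t) ij.1 ij.2) <= K * (t - s) ^+ 2.
  case: ij => i j /=; have [sr si] := sb i j.
  have [K1 K10 H1] := @smooth_lip _ a b sr; have [K2 K20 H2] := @smooth_lip _ a b si.
  exists (K1 + K2); split; first exact: addr_ge0.
  move=> s t as_ st tb; rewrite /normsq !mxE Re_addc Im_addc Re_oppc Im_oppc mulrDl.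
  by rewrite lerD ?H1 ?H2.
have [K KP] := choice H.
exists (\sum_i \sum_j K (i, j)).
  by apply: sumr_ge0 => i _; apply: sumr_ge0 => j _; case: (KP (i, j)).
move=> s t as_ st tb; rewrite mulr_suml; apply: ler_sum => i _.
rewrite mulr_suml; apply: ler_sum => j _.
by case: (KP (i, j)) => _; exact.
Qed.

Lemma cderiv_entry beta (A B : mx) i j : smooth_mx beta ->
  cderiv (fun t => (A *m beta t *m B) i j)
         (fun t => (A *m mderiv beta t *m B) i j).
Proof.
move=> sb.
have E (x : mx) : (A *m x *m B) i j = \sum_l \sum_k B l j * (A i k * x k l).
  rewrite mxE; apply: eq_bigr => l _; rewrite mxE mulr_suml.
  by apply: eq_bigr => k _; rewrite mulrC.
apply: (eq_cderiv (fun t => esym (E (beta t))) (fun t => esym (E (mderiv beta t)))).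
apply: cderiv_sum => l; apply: cderiv_sum => k.
apply: cderivM; apply: cderivM => t; have [sr si] := sb k l.
have [Dr _] := smooth_derive sr; have [Di _] := smooth_derive si.
by split; rewrite mxE/=.
Qed.

Definition mxcont beta := forall i j, ccont (fun t => beta t i j).

Lemma mxcontM (f g : R -> mx) : mxcont f -> mxcont g ->
  mxcont (fun t => f t *m g t).
Proof.
move=> cf cg i j; under eq_fun do rewrite mxE.
by apply: ccont_sum => k; exact: ccontM.
Qed.

Lemma mxcontX (f : R -> mx) k : mxcont f -> mxcont (fun t => f t ^+ k).
Proof.
move=> cf; elim: k => [|k IH] i j.
  by under eq_fun do rewrite expr0; exact: ccont_cst.
under eq_fun do rewrite exprS -[_ * _]/(_ *m _).
exact: mxcontM.
Qed.

Lemma mxcont_adj (f : R -> mx) : mxcont f -> mxcont (fun t => adj (f t)).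
Proof.
by move=> cf i j; under eq_fun do rewrite adjE; exact: ccont_conjc.
Qed.

Lemma schatten_ge0 p (x : mx) : 0 <= schatten_even p x.
Proof. exact: powR_ge0. Qed.

Lemma speed_continuous p beta : (0 < p)%N -> smooth_mx beta ->
  continuous (fun t => schatten_even p (mderiv beta t)).
Proof.
move=> p0 sb; apply: continuous_root => // [t|]; first exact: tr_gramX_ge0.
have cb : mxcont (mderiv beta).
  move=> i j; have [sr si] := sb i j.
  have [_ cr] := smooth_derive sr; have [_ ci] := smooth_derive si.
  by split; under eq_fun do rewrite mxE/=.
suff : ccont (fun t => \tr ((adj (mderiv beta t) *m mderiv beta t) ^+ p./2)).
  by case.
apply: ccont_sum => i.
exact: (mxcontX _ (mxcontM (mxcont_adj cb) cb)).
Qed.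

(** The function c S - q has nonnegative derivative. The derivative of [S] is obtained only to the
    right of [a], so the mean value theorem is applied with interior derivatives and continuity on
    the closed segment. With q = 0 it also shows that [S] is monotone. *)
Lemma integral_comparison (f q dq : R -> R) a b c : 0 <= c -> continuous f ->
  (forall t, is_derive t (1 : R) q (dq t)) ->
  (forall t, a <= t <= b -> dq t <= c * f t) ->
  let S x := Rintegral mu `[a, x] f in
  forall s t, a <= s -> s <= t -> t <= b -> q t - q s <= c * (S t - S s).
Proof.
move=> c0 cf Dq H S s t as_ st tb.
have ab : a <= b := le_trans as_ (le_trans st tb).
have fint u : mu.-integrable `[a, u] (EFin \o f).
  apply: continuous_compact_integrable; first exact: segment_compact.
  exact: continuous_subspaceT.
have cS : {within `[a, b], continuous S} by exact: parameterized_integral_continuous.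
have DS x : a < x -> is_derive x (1 : R) S (f x).
  move=> ax; have xu : x < x + 1 by rewrite ltrDl.
  have [dS <-] := continuous_FTC1_closed xu (fint _) ax (cf x).
  by rewrite derive1E; exact: derivableP.
have cq : continuous q.
  by move=> x; apply/differentiable_continuous/derivable1_diffP; case: (Dq x).
pose r x := c * S x - q x.
have [||d dst] := @MVT_segment _ r (fun x => c * f x - dq x) s t st.
- move=> x; rewrite in_itv/= => /andP[sx xt].
  have := DS x (le_lt_trans as_ sx) => DSx.
  by apply: is_deriveB; exact: is_deriveZ.
- have cS' : {within `[s, t], continuous S}.
    apply: continuous_subspaceW cS => x /=; rewrite !in_itv/= => /andP[sx xt].
    by rewrite (le_trans as_)// (le_trans xt).
  have cq' : {within `[s, t], continuous q} by exact: continuous_subspaceT.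
  move=> x; apply: cvgB; last exact: cq'.
  by apply: cvgM; [exact: cvg_cst|exact: cS'].
rewrite /r => E.
have : 0 <= (c * f d - dq d) * (t - s).
  rewrite mulr_ge0 ?subr_ge0//; apply: H.
  move: dst; rewrite in_itv/= => /andP[sd dt].
  by rewrite (le_trans as_)// (le_trans dt).
by rewrite -E => h; lra.
Qed.

End Speed.

(** * Lower bound for the length of an arbitrary curve *)

Section LowerBound.
Variables (R : realType) (n : nat).
Local Notation C := R[i].
Local Notation mx := 'M[C]_n.
Local Notation mu := (@lebesgue_measure R).
Implicit Types (beta : R -> mx) (p : nat) (u v P Q : mx).

Lemma schatten_evenX p (x : mx) : (0 < p)%N ->
  schatten_even p x ^+ p = complex.Re (\tr ((adj x *m x) ^+ p./2)).
Proof. by move=> p0; rewrite rootK// tr_gramX_ge0. Qed.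

(** |Im z|^p <= (|z|^2)^(p/2), so pinching with exponent p/2 bounds the second Hoelder factor by the
    Schatten norm. *)
Lemma hoelder_schatten p (th : 'I_n -> R) (x P Q : mx) (X : R) :
  (1 < p)%N -> ~~ odd p -> unitary P -> unitary Q -> 0 <= X ->
  \sum_j th j ^+ p = X ^+ p ->
  \sum_j p%:R * th j ^+ p.-1 * complex.Im ((Q *m x *m adj P) j j) <=
  p%:R * X ^+ p.-1 * schatten_even p x.
Proof.
move=> p1 op PP QQ X0 XE; have p0 : (0 < p)%N by exact: ltnW.
have evenX (t : R) : `|t| ^+ p = t ^+ p.
  by rewrite -normrX ger0_norm// exprn_even_ge0.
apply: (@le_trans _ _ (p%:R *
    \sum_j `|th j| ^+ p.-1 * `|complex.Im ((Q *m x *m adj P) j j)|)).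
  rewrite mulr_sumr; apply: ler_sum => j _; rewrite -mulrA ler_wpM2l//.
  by rewrite -normrX -normrM ler_norm.
rewrite -mulrA ler_wpM2l// hoelder_sum ?schatten_ge0//.
  by under eq_bigr do rewrite evenX; rewrite XE.
rewrite schatten_evenX//; apply: le_trans (pinching x p./2 PP QQ).
apply: ler_sum => j _; rewrite evenX.
rewrite -{1}(even_halfK op) -mul2n exprM lerXn2r ?nnegrE ?sqr_ge0 ?normsq_ge0//.
by rewrite /normsq lerDr sqr_ge0.
Qed.

(** For a step from s to t, the angles and eigenbasis at s are frozen. The first-order term is then
    linear in beta(t) and vanishes at t = s, so it is the increment of a differentiable function [q]
    whose derivative Hoelder bounds by p g(s)^(p-1) times the speed. This is the hypothesis of
    [root_growth]. *)
Lemma piece_bound p beta u a b : (1 < p)%N -> ~~ odd p -> smooth_mx beta ->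
  a <= b -> unitary u -> (forall s, a <= s <= b -> unitary (beta s)) ->
  spow p (adj u *m beta b) `^ p%:R^-1 <= spow p (adj u *m beta a) `^ p%:R^-1
    + Rintegral mu `[a, b] (fun s => schatten_even p (mderiv beta s)).
Proof.
move=> p1 op sb ab uu ub; have p0 : (0 < p)%N by exact: ltnW.
pose sp s := schatten_even p (mderiv beta s).
have csp : continuous sp by exact: speed_continuous.
pose S x := Rintegral mu `[a, x] sp.
have Sa : S a = 0 by rewrite /S set_itv1 Rintegral_set1.
have [K K0 HK] := @angdec_semiconcave R n p op.
have [L L0 HL] := @smooth_mx_lip R n beta a b sb.
have [g [g0 gX gE]] : exists g : R -> R, [/\ forall s, 0 <= g s,
    forall s, g s ^+ p = spow p (adj u *m beta s) &
    forall s, spow p (adj u *m beta s) `^ p%:R^-1 = g s].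
  exists (fun s => spow p (adj u *m beta s) `^ p%:R^-1); split => // s.
    exact: powR_ge0.
  by rewrite rootK// spow_ge0.
rewrite !gE -/(S b) -[S b]subr0 -Sa.
apply: (@root_growth R p g S a b (K * L)) => //.
- exact: mulr_ge0.
- move=> s t as_ st tb; rewrite -subr_ge0 -[S t - S s]mul1r.
  have := @integral_comparison R sp (fun=> 0) (fun=> 0) a b 1 ler01 csp.
  rewrite -/S subrr; apply => // x _.
  by rewrite mul1r schatten_ge0.
move=> s t as_ st tb; rewrite (gX t) (gX s).
have us : unitary (beta s) by apply: ub; rewrite as_ (le_trans st).
have ut : unitary (beta t) by apply: ub; rewrite tb (le_trans as_).
have uau := unitary_adj uu.
have [P [th dP]] := unitary_angdec (unitary_mul uau us).
have [Q [psi dQ]] := unitary_angdec (unitary_mul uau ut).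
have XY x : adj (adj u *m beta s) *m (adj u *m x) = adj (beta s) *m x.
  by rewrite adjM adjK -mulmxA (mulmxA u) unitaryVr// mul1mx.
have PP : unitary P by case: dP.
have := HK _ _ _ _ _ _ dP dQ; rewrite -(spowE op dP) -(spowE op dQ).
have -> : frob (adj u *m beta s - adj u *m beta t) = frob (beta s - beta t).
  by rewrite !frobB_unitary ?XY//; exact: unitary_mul.
move=> H; apply: le_trans H _; apply: lerD; last first.
  by rewrite -mulrA ler_wpM2l// HL.
rewrite lerD2l XY.
pose c j : R := p%:R * th j ^+ p.-1.
pose F (j : 'I_n) (x : mx) : C :=
  Complex (c j) 0 * (P *m adj (beta s) *m x *m adj P) j j.
have ImF j x : complex.Im (F j x) =
    c j * complex.Im ((P *m adj (beta s) *m x *m adj P) j j).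
  by rewrite /F Im_mulc /= mul0r addr0.
have D := @cderiv_sum _ _ (index_enum 'I_n) _ _
  (fun j => cderivM (Complex (c j) 0)
    (@cderiv_entry R n beta (P *m adj (beta s)) (adj P) j j sb)).
pose q x := complex.Im (\sum_j F j (beta x)).
have -> : \sum_j p%:R * th j ^+ p.-1 *
    complex.Im (dg P (adj (beta s) *m beta t) j) = q t - q s.
  have -> : q s = 0.
    rewrite /q Im_sum big1// => j _; rewrite ImF -(mulmxA P).
    by rewrite -/(dg P _ j) dgI_unitary//= mulr0.
  rewrite subr0 /q Im_sum; apply: eq_bigr => j _.
  by rewrite ImF /dg !mulmxA.
have := @integral_comparison R sp q (fun x => complex.Im (\sum_j F j (mderiv beta x)))
  a b (p%:R * g s ^+ p.-1); rewrite -/S; apply => //.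
- by rewrite mulr_ge0// exprn_ge0.
- by move=> x; case: (D x).
move=> x _; rewrite Im_sum.
under eq_bigr do rewrite ImF.
apply: hoelder_schatten => //.
  by apply: unitary_mul => //; exact: unitary_adj.
by rewrite gX (spowE op dP).
Qed.

Lemma path_length_ge p u v L : (1 < p)%N -> ~~ odd p ->
  path_lengths (schatten_even p) unitary u v L ->
  spow p (adj u *m v) `^ p%:R^-1 <= L.
Proof.
move=> p1 op [a [b [al [k [t [beta]]]]]].
move=> [t0 [tk [mt [ala [alb [unit_al [pieces ->]]]]]]].
have tle i j : (i <= j)%N -> (j <= k)%N -> t i <= t j.
  elim: j => [|j IH]; first by rewrite leqn0 => /eqP ->.
  rewrite leq_eqVlt => /predU1P[->//|]; rewrite ltnS => ij jk.
  by apply: le_trans (IH ij (ltnW jk)) (ltW (mt _ jk)).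
have ab : a <= b by rewrite -t0 -tk tle.
have uu : unitary u by rewrite -ala; apply: unit_al; rewrite lexx.
(* The base point [u] stays fixed while the pieces are added, so the bounds telescope without a
   triangle inequality. *)
suff H i : (i <= k)%N -> spow p (adj u *m al (t i)) `^ p%:R^-1 <=
    \sum_(j < i) Rintegral mu `[t j, t j.+1]
       (fun s => schatten_even p (mderiv (beta j) s)).
  by have := H k (leqnn k); rewrite tk alb.
elim: i => [_|i IH ik].
  rewrite big_ord0 t0 ala uu spow1 ?(ltnW p1)// powR0//.
  by rewrite invr_eq0 pnatr_eq0 -lt0n ltnW.
rewrite big_ord_recr/=.
have [sb eqb] := pieces i ik.
have ii1 := ltW (mt i ik).
rewrite eqb ?lexx ?andbT//.
apply: le_trans (piece_bound p1 op sb ii1 uu _) _.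
  move=> s /andP[s1 s2]; rewrite -eqb ?s1//; apply: unit_al.
  by rewrite -t0 -tk (le_trans (tle 0%N i _ (ltnW ik)))//= (le_trans s2)// tle.
by rewrite lerD2r -eqb ?lexx// IH// ltnW.
Qed.

End LowerBound.

Lemma cvg_lincomb (R : realType) (f g : R^nat) (x y c d : R) :
  f @ \oo --> x -> g @ \oo --> y ->
  (fun N => c * f N + d * g N) @ \oo --> c * x + d * y.
Proof.
by move=> hf hg; apply: cvgD; apply: cvgM => //; exact: cvg_cst.
Qed.

(** * Smoothness of trigonometric sums *)

Section TrigSums.
Variables (R : realType) (n : nat).
Implicit Types (a b th : 'I_n -> R) (t : R).

(** The shape of the real and imaginary parts of the entries of t -> u exp (t y); differentiation
    only changes the coefficients, which gives smoothness of all orders. *)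
Definition trig_sum th a b t : R :=
  \sum_l (a l * cos (th l * t) + b l * sin (th l * t)).

Lemma is_derive_trig_sum th a b t : is_derive t (1 : R) (trig_sum th a b)
  (trig_sum th (fun l => th l * b l) (fun l => - (th l * a l)) t).
Proof.
have -> : trig_sum th a b =
    \sum_(l < n) (fun t => a l * cos (th l * t) + b l * sin (th l * t)).
  by apply/funext => s; rewrite fct_sumE.
apply: is_derive_sum => l; apply: is_derive_eq.
rewrite -[LHS]/(a l * (- sin (th l * t) * (th l * 1))
               + b l * (cos (th l * t) * (th l * 1))); ring.
Qed.

Lemma derive1_trig_sum th a b : derive1 (trig_sum th a b) =
  trig_sum th (fun l => th l * b l) (fun l => - (th l * a l)).
Proof.
by apply/funext => t; rewrite derive1E; case: (is_derive_trig_sum th a b t).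
Qed.

Lemma smooth_trig_sum th a b : smooth (trig_sum th a b).
Proof.
move=> k; have [a' [b' ->]] : exists a' b', derive1n k (trig_sum th a b) =
    trig_sum th a' b'.
  elim: k => [|k [a' [b' IH]]]; first by exists a, b.
  by rewrite derive1nS IH derive1_trig_sum; do 2 eexists.
by move=> x; case: (is_derive_trig_sum th a' b' x).
Qed.

End TrigSums.

(** * One-parameter subgroups: their lengths, the exponential and the logarithm *)

Section Geodesics.
Variables (R : realType) (n : nat).
Local Notation C := R[i].
Local Notation mx := 'M[C]_n.
Local Notation mu := (@lebesgue_measure R).
Implicit Types (p : nat) (u v P Q : mx) (th : 'I_n -> R) (w : 'cV[C]_n).

Definition geo u P th t : mx := u *m sdec P (fun l => expi (th l * t)).

Definition geo_coef u P i j (l : 'I_n) : C := (u *m adj P) i l * P l j.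

Lemma mul_sdec_entry u P d i j :
  (u *m sdec P d) i j = \sum_l geo_coef u P i j l * d l.
Proof.
rewrite /sdec !mulmxA mxE; apply: eq_bigr => l _.
by rewrite mul_mx_diag !mxE /geo_coef mxE; ring.
Qed.

Lemma geo_Re u P th i j : (fun t => complex.Re (geo u P th t i j)) =
  trig_sum th (fun l => complex.Re (geo_coef u P i j l))
              (fun l => - complex.Im (geo_coef u P i j l)).
Proof.
apply/funext => t; rewrite /geo mul_sdec_entry Re_sum; apply: eq_bigr => l _.
by rewrite Re_mulc /= mulNr.
Qed.

Lemma geo_Im u P th i j : (fun t => complex.Im (geo u P th t i j)) =
  trig_sum th (fun l => complex.Im (geo_coef u P i j l))
              (fun l => complex.Re (geo_coef u P i j l)).
Proof.
apply/funext => t; rewrite /geo mul_sdec_entry Im_sum; apply: eq_bigr => l _.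
by rewrite Im_mulc /= addrC.
Qed.

Lemma smooth_geo u P th : smooth_mx (geo u P th).
Proof.
by move=> i j; rewrite geo_Re geo_Im; split; exact: smooth_trig_sum.
Qed.

Lemma mderiv_geo u P th t : mderiv (geo u P th) t =
  u *m sdec P (fun l => expi (th l * t) * Complex 0 (th l)).
Proof.
apply/matrixP => i j; rewrite mxE geo_Re geo_Im !derive1_trig_sum mul_sdec_entry.
apply: complex_inj; rewrite ?Re_sum ?Im_sum; apply: eq_bigr => l _.
  by rewrite !Re_mulc Im_mulc /=; ring.
by rewrite !Im_mulc Re_mulc /=; ring.
Qed.

(** [N] is left arbitrary so that one curve serves both the Schatten norms and the operator norm;
    each has constant speed by unitary invariance. *)
Lemma geodesic_length (N : mx -> R) u v P th c : unitary u ->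
  angdec (adj u *m v) P th ->
  (forall t, N (u *m sdec P (fun l => expi (th l * t) * Complex 0 (th l))) = c) ->
  path_lengths N unitary u v c.
Proof.
move=> uu [PP _ E] Nc.
exists 0, 1, (geo u P th), 1%N, (fun i => i%:R), (fun=> geo u P th).
split => //; split => //; split; first by case.
split.
  rewrite /geo; have -> : (fun l => expi (th l * 0)) = fun=> 1.
    by apply/funext => l; rewrite mulr0 expi0.
  by rewrite sdec1// mulmx1.
split.
  rewrite /geo; have -> : (fun l => expi (th l * 1)) = fun l => expi (th l).
    by apply/funext => l; rewrite mulr1.
  by rewrite -E mulmxA unitaryVr// mul1mx.
split.
  move=> s _; apply: unitary_mul => //; apply: unitary_sdec => // j.
  exact: normsq_expi.
split; first by move=> i _; split => //; exact: smooth_geo.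
rewrite big_ord_recl big_ord0 addr0 /=.
have -> : (fun s => N (mderiv (geo u P th) s)) = fun=> c.
  by apply/funext => s; rewrite mderiv_geo Nc.
rewrite Rintegral_cst//.
have h : c = c * fine (mu `[0 : R, 1]).
  by rewrite lebesgue_measure_itv/= lte_fin ltr01 oppr0 adde0 mulr1.
exact: h.
Qed.

Lemma schatten_geo p u P th t : (0 < p)%N -> ~~ odd p -> unitary u -> unitary P ->
  schatten_even p (u *m sdec P (fun l => expi (th l * t) * Complex 0 (th l))) =
  (\sum_j th j ^+ p) `^ p%:R^-1.
Proof.
move=> p0 op uu PP; rewrite /schatten_even; congr (_ `^ _).
rewrite adjM -mulmxA (mulmxA _ u) uu mul1mx adj_sdec sdecM// sdecX// tr_sdec//.
rewrite Re_sum; apply: eq_bigr => j _.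
rewrite -normsqE normsqM normsq_expi mul1r /normsq/= expr0n/= add0r.
rewrite -(rmorphXn (real_complex R))/= -exprM mul2n.
by rewrite even_halfK.
Qed.

Lemma d_evenE p u v : (1 < p)%N -> ~~ odd p -> unitary u -> unitary v ->
  d_even p u v = spow p (adj u *m v) `^ p%:R^-1.
Proof.
move=> p1 op uu vv; have p0 : (0 < p)%N by exact: ltnW.
have [P [th dP]] := unitary_angdec (unitary_mul (unitary_adj uu) vv).
have mem : path_lengths (schatten_even p) unitary u v
    (spow p (adj u *m v) `^ p%:R^-1).
  apply: (geodesic_length uu dP) => t.
  by rewrite (spowE op dP) schatten_geo//; case: dP.
have lb : lbound (path_lengths (schatten_even p) unitary u v)
    (spow p (adj u *m v) `^ p%:R^-1).
  by move=> L; exact: path_length_ge.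
apply/eqP; rewrite eq_le; apply/andP; split.
  by apply: ge_inf => //; exists (spow p (adj u *m v) `^ p%:R^-1).
by apply: lb_le_inf => //; exists (spow p (adj u *m v) `^ p%:R^-1).
Qed.

Lemma vnormE w : vnorm w = Num.sqrt (\sum_i normsq (w i 0)).
Proof. by []. Qed.

Lemma sum_normsq_unitary u w : unitary u ->
  \sum_i normsq ((u *m w) i 0) = \sum_i normsq (w i 0).
Proof.
move=> uu; pose star (w : 'cV[C]_n) : 'rV[C]_n := (map_mx (@conjc R) w)^T.
have E (x : 'cV[C]_n) : \sum_i normsq (x i 0) = complex.Re ((star x *m x) 0 0).
  rewrite mxE Re_sum; apply: eq_bigr => i _.
  by rewrite !mxE -normsqE.
rewrite !E; congr complex.Re; congr (fun_of_matrix _ 0 0).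
rewrite /star map_mxM trmx_mul -mulmxA (mulmxA _ u w).
by rewrite -/(adj u) uu mul1mx.
Qed.

Lemma vnorm_unitary u w : unitary u -> vnorm (u *m w) = vnorm w.
Proof. by move=> uu; rewrite !vnormE sum_normsq_unitary. Qed.

Lemma opnorm_unitary u x : unitary u -> opnorm (u *m x) = opnorm x.
Proof.
move=> uu; rewrite /opnorm; congr sup.
apply/seteqP; split => r [w w1 <-]; exists w => //.
  by rewrite -mulmxA (vnorm_unitary _ uu).
by rewrite -mulmxA (vnorm_unitary _ uu).
Qed.

Lemma opnorm_ge0 (x : mx) : 0 <= opnorm x.
Proof.
rewrite /opnorm; set A := [set _ | _ in _].
have A0 r : A r -> 0 <= r by move=> [w _ <-]; rewrite vnormE sqrtr_ge0.
(* [sup] takes the value 0 when the set has no supremum, in particular when n = 0 and there are no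
   unit vectors. *)
have [[[r Ar] ubA]|/sup_out ->//] := pselect (has_sup A).
exact: le_trans (A0 _ Ar) (ub_le_sup ubA Ar).
Qed.

Lemma opnorm_skew_lt P th : unitary P -> (forall j, `|th j| < pi) ->
  opnorm (sdec P (fun l => Complex 0 (th l))) < pi.
Proof.
move=> PP thpi.
(* A supremum of numbers below pi could equal pi; the largest angle [r] preserves strictness. *)
have [r [r0 rpi rth]] : exists r : R, [/\ 0 <= r, r < pi & forall j, `|th j| <= r].
  exists (\big[Num.max/0]_j `|th j|); split.
  - exact: bigmax_ge_id.
  - by apply: bigmax_lt => //; exact: pi_gt0.
  - by move=> j; exact: le_bigmax.
apply: le_lt_trans rpi; rewrite /opnorm; set A := [set _ | _ in _].
have [->|/set0P A0] := eqVneq A set0; first by rewrite sup0.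
apply: ge_sup => // s [w w1 <-].
have -> : r = r * vnorm (P *m w) by rewrite vnorm_unitary// w1 mulr1.
rewrite /sdec -!mulmxA vnorm_unitary ?vnormE; last exact: unitary_adj.
rewrite -{1}(ger0_norm r0) -sqrtr_sqr -sqrtrM ?sqr_ge0// ler_wsqrtr//.
rewrite mulr_sumr; apply: ler_sum => i _; rewrite mul_diag_mx [X in normsq X]mxE.
rewrite normsqM ler_wpM2r ?normsq_ge0// mxE /normsq/= expr0n add0r.
by rewrite -(real_normK (num_real (th i))) lerXn2r ?nnegrE.
Qed.

Lemma d_inf_lt u v P th : unitary u -> angdec (adj u *m v) P th ->
  (forall j, `|th j| < pi) -> d_inf u v < pi.
Proof.
move=> uu dP thpi; have PP : unitary P by case: dP.
apply: le_lt_trans (opnorm_skew_lt PP thpi); apply: ge_inf.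
  exists 0 => L [a [b [al [k [t [beta [_ [_ [_ [_ [_ [_ [_ ->]]]]]]]]]]]]].
  apply: sumr_ge0 => i _; apply: Rintegral_ge0 => s _; exact: opnorm_ge0.
apply: (geodesic_length uu dP) => t.
rewrite (opnorm_unitary _ uu) -(sdecM _ _ PP) opnorm_unitary//.
by apply: unitary_sdec => // j; exact: normsq_expi.
Qed.

Lemma exp_partial_expi (a : R) N :
  \sum_(k < N) ((k`!)%:R : C)^-1 * Complex 0 a ^+ k =
  Complex (series (cos_coeff a) N) (series (sin_coeff a) N).
Proof.
have H k : ((k`!)%:R : C)^-1 * Complex 0 a ^+ k =
    Complex (cos_coeff a k) (sin_coeff a k).
  have -> : ((k`!)%:R : C)^-1 = Complex ((k`!)%:R^-1) 0.
    have -> : ((k`!)%:R : C) = (real_complex R) (k`!)%:R by rewrite rmorph_nat.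
    by rewrite -fmorphV.
  have -> : Complex 0 a ^+ k = Complex ((~~ odd k)%:R * (-1) ^+ k./2 * a ^+ k)
                                 ((odd k)%:R * (-1) ^+ k.-1./2 * a ^+ k).
    elim: k => [|k IH]; first by rewrite !expr0 !mulr1.
    rewrite exprS IH; apply: complex_inj; rewrite ?Re_mulc ?Im_mulc/= !mul0r.
      rewrite negbK sub0r exprS; case: k {IH} => [|k] /=.
        by rewrite !mul0r mulr0 oppr0.
      by rewrite (exprS (-1)); ring.
    by rewrite add0r exprS; ring.
  apply: complex_inj; rewrite ?Re_mulc ?Im_mulc/= /cos_coeff /sin_coeff/=.
    by rewrite mul0r subr0 mulrC.
  by rewrite mul0r addr0 mulrC.
apply: complex_inj; rewrite ?Re_sum ?Im_sum/= /series/= big_mkord.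
  by apply: eq_bigr => k _; rewrite H.
by apply: eq_bigr => k _; rewrite H.
Qed.

Lemma expm_sdec P (a : 'I_n -> R) : unitary P ->
  expm (sdec P (fun l => Complex 0 (a l))) = sdec P (fun l => expi (a l)).
Proof.
move=> PP; set y := sdec P _.
have E N i j : exp_partial y N i j =
    \sum_l geo_coef 1%:M P i j l
       * Complex (series (cos_coeff (a l)) N) (series (sin_coeff (a l)) N).
  rewrite /exp_partial /y; under eq_bigr do rewrite sdecX// sdecZ.
  rewrite summxE; under eq_bigr do rewrite -[sdec P _]mul1mx mul_sdec_entry.
  rewrite exchange_big; apply: eq_bigr => l _.
  by rewrite -mulr_sumr exp_partial_expi.
have ccos (x : R) : series (cos_coeff x) @ \oo --> cos x.
  by rewrite unlock; exact: is_cvg_series_cos_coeff.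
have csin (x : R) : series (sin_coeff x) @ \oo --> sin x.
  by rewrite unlock; exact: is_cvg_series_sin_coeff.
apply/matrixP => i j; rewrite mxE -[sdec P _ in RHS]mul1mx mul_sdec_entry.
apply: complex_inj => /=; apply/cvg_lim => //.
  have -> : (fun N => complex.Re (exp_partial y N i j)) = (fun N =>
      \sum_l (complex.Re (geo_coef 1%:M P i j l) * series (cos_coeff (a l)) N
              + - complex.Im (geo_coef 1%:M P i j l) * series (sin_coeff (a l)) N)).
    apply/funext => N; rewrite E Re_sum; apply: eq_bigr => l _.
    by rewrite Re_mulc mulNr.
  rewrite Re_sum; apply: cvg_big => [|l _]; first exact: add_continuous.
  have -> : complex.Re (geo_coef 1%:M P i j l * expi (a l)) =
      complex.Re (geo_coef 1%:M P i j l) * cos (a l)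
      + - complex.Im (geo_coef 1%:M P i j l) * sin (a l) by rewrite Re_mulc mulNr.
  exact: cvg_lincomb.
have -> : (fun N => complex.Im (exp_partial y N i j)) = (fun N =>
    \sum_l (complex.Re (geo_coef 1%:M P i j l) * series (sin_coeff (a l)) N
            + complex.Im (geo_coef 1%:M P i j l) * series (cos_coeff (a l)) N)).
  by apply/funext => N; rewrite E Im_sum; apply: eq_bigr => l _; rewrite Im_mulc.
rewrite Im_sum; apply: cvg_big => [|l _]; first exact: add_continuous.
have -> : complex.Im (geo_coef 1%:M P i j l * expi (a l)) =
    complex.Re (geo_coef 1%:M P i j l) * sin (a l)
    + complex.Im (geo_coef 1%:M P i j l) * cos (a l) by rewrite Im_mulc.
exact: cvg_lincomb.
Qed.

Lemma angdec_is_log u P th : angdec u P th -> (forall j, `|th j| < pi) ->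
  is_log u (sdec P (fun l => Complex 0 (th l))).
Proof.
move=> [PP _ ->] thpi; split; last first.
  by split; [exact: opnorm_skew_lt|exact: expm_sdec].
rewrite /skew_herm/= adj_sdec -scaleN1r sdecZ; congr sdec.
by apply/funext => l; apply: complex_inj; rewrite ?Re_mulc ?Im_mulc/=; ring.
Qed.

End Geodesics.

(** * Convexity at the midpoint of a short geodesic *)

Section Midpoint.
Variables (R : realType) (n : nat).
Local Notation C := R[i].
Local Notation mx := 'M[C]_n.
Implicit Types (p : nat) (u v m P Q : mx) (th psi : 'I_n -> R) (rho : R).

Lemma convex_comb_gt0 (I : finType) (w f : I -> R) :
  (forall i, 0 <= w i) -> \sum_i w i = 1 -> (forall i, 0 < f i) ->
  0 < \sum_i w i * f i.
Proof.
move=> w0 w1 f0; have wf0 i : true -> 0 <= w i * f i by rewrite mulr_ge0// ltW.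
rewrite lt_neqAle sumr_ge0// andbT; apply/negP => /eqP/esym/(psumr_eq0P wf0) h.
have : \sum_i w i = 0.
  apply: big1 => i _; have /eqP := h i isT.
  by rewrite mulf_eq0 (gt_eqF (f0 i)) orbF => /eqP.
by rewrite w1 => /eqP; rewrite oner_eq0.
Qed.

(** A diagonal entry in any orthonormal basis is a convex combination of the eigenvalues, all of
    which have positive real part. *)
Lemma Re_dg_gt0 u P Q th k : angdec u P th -> unitary Q ->
  (forall j, `|th j| < pi / 2) -> 0 < complex.Re (dg Q u k).
Proof.
move=> [PP _ ->] QQ thp; rewrite Re_dg_sdec convex_comb_gt0//.
- by move=> l; exact: wt_ge0.
- exact: wt_sumr.
- by move=> l /=; apply: cos_gt0_pihalf; rewrite -ltr_norml.
Qed.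

(* If [exp (i th_j) = -1], then [u] and [v = u (u^* v)] have opposite diagonal
   entries in an eigenbasis of [u^* v], against [Re_dg_gt0]. *)
Lemma half_plane_angle_lt u v P th Pu thu Pv thv :
  angdec u Pu thu -> (forall j, `|thu j| < pi / 2) ->
  angdec v Pv thv -> (forall j, `|thv j| < pi / 2) ->
  angdec (adj u *m v) P th -> forall j, `|th j| < pi.
Proof.
move=> du hu dv hv [PP thpi E] j; rewrite lt_neqAle thpi andbT.
apply/negP => /eqP thj.
have uu := angdec_unitary du.
have eN1 : expi (th j) = -1.
  apply: complex_inj => /=; first by rewrite -cos_norm thj cospi.
  rewrite oppr0; move: thj; have [_ ->|_ /(congr1 -%R)] := ger0P (th j).
    exact: sinpi.
  by rewrite opprK => ->; rewrite sinN sinpi oppr0.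
have : dg P v j = - dg P u j.
  have {1}-> : v = u *m (adj u *m v) by rewrite mulmxA unitaryVr// mul1mx.
  by rewrite E dg_mulr// eN1 mulrN1.
move=> /(congr1 (@complex.Re R)); rewrite Re_oppc.
have := Re_dg_gt0 j du PP hu; have := Re_dg_gt0 j dv PP hv; lra.
Qed.

(** With w the square root of u^* v and m = u w, u + v = m (w^* + w), and w^* + w is positive
    definite because |th_j| < pi. In an eigenbasis of m the diagonal entries of u + v are therefore
    positive multiples of exp (i psi_k), and their real parts are positive. *)
Lemma midpoint_angle_lt u v P th Pu thu Pv thv Q psi :
  angdec u Pu thu -> (forall j, `|thu j| < pi / 2) ->
  angdec v Pv thv -> (forall j, `|thv j| < pi / 2) ->
  angdec (adj u *m v) P th -> (forall j, `|th j| < pi) ->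
  angdec (u *m sdec P (fun j => expi (th j / 2))) Q psi ->
  forall k, `|psi k| < pi / 2.
Proof.
move=> du hu dv hv [PP _ E] thpi [QQ psipi mE] k.
have uu := angdec_unitary du.
set w := sdec P _ in mE.
have ww : unitary w by apply: unitary_sdec => // j; exact: normsq_expi.
have wwE : adj u *m v = w *m w.
  rewrite E /w sdecM//; congr sdec; apply/funext => j.
  by rewrite -expiD; congr expi; field.
have uvE : u + v = sdec Q (fun j => expi (psi j)) *m
    sdec P (fun j => Complex (2 * cos (th j / 2)) 0).
  have -> : sdec P (fun j => Complex (2 * cos (th j / 2)) 0) = adj w + w.
    rewrite /w adj_sdec sdecD; congr sdec; apply/funext => j.
    by apply: complex_inj; rewrite ?Re_addc ?Im_addc /=; ring.
  rewrite -mE mulmxDr -(mulmxA u w (adj w)) (unitaryVr ww) mulmx1.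
  by rewrite -(mulmxA u w w) -wwE (mulmxA u) (unitaryVr uu) mul1mx.
have : complex.Re (dg Q (u + v) k) = cos (psi k) *
    complex.Re (dg Q (sdec P (fun j => Complex (2 * cos (th j / 2)) 0)) k).
  rewrite uvE dg_mull// Re_mulc Im_dg_sdec big1 ?mulr0 ?subr0// => l _.
  by rewrite mulr0.
rewrite dgD Re_addc => h.
have h1 := Re_dg_gt0 k du QQ hu; have h2 := Re_dg_gt0 k dv QQ hv.
have h3 : 0 < complex.Re (dg Q (sdec P (fun j => Complex (2 * cos (th j / 2)) 0)) k).
  rewrite Re_dg_sdec convex_comb_gt0//.
  - by move=> l; exact: wt_ge0.
  - exact: wt_sumr.
  - move=> l /=; rewrite mulr_gt0//; apply: cos_gt0_pihalf.
    by move: (thpi l); rewrite ltr_norml => /andP[? ?]; lra.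
have cpos : 0 < cos (psi k).
  by rewrite -(pmulr_lgt0 _ h3) -h addr_gt0.
rewrite ltNge; apply/negP => hk; move: cpos.
rewrite -cos_norm ltNge -[X in _ <= X](@cos_pihalf R) cos_le//.
by rewrite divr_ge0// pi_ge0.
Qed.

(** [spectral_transfer] gives upper bounds; this lower bound is its application to the negated
    inequality. *)
Lemma spow_tangent p u m P th Q psi (b : 'I_n -> R) (c : R) :
  ~~ odd p -> angdec u P th -> angdec m Q psi ->
  (forall j k, psi j ^+ p + b j * sin (th k - psi j)
               + c * (1 - cos (th k - psi j)) <= th k ^+ p) ->
  spow p m + \sum_j b j * complex.Im (dg Q (adj m *m u) j)
    + c / 2 * frob (m - u) <= spow p u.
Proof.
move=> op du dm H; rewrite (spowE op du) (spowE op dm).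
have uu := angdec_unitary du; have mm := angdec_unitary dm.
rewrite frobB_unitary//.
rewrite mulrA divfK ?pnatr_eq0//.
case: du dm => [PP _ uE] [QQ _ mE].
have := @spectral_transfer R n m u Q P psi th (fun k => - th k ^+ p)
  (fun j => - psi j ^+ p) (fun j => - b j) (- c) QQ PP mE uE.
rewrite !sumrN.
have -> : \sum_j - b j * complex.Im (dg Q (adj m *m u) j) =
    - \sum_j b j * complex.Im (dg Q (adj m *m u) j).
  by rewrite -sumrN; apply: eq_bigr => j _; rewrite mulNr.
move=> h; suff : - \sum_(i < n) th i ^+ p <= - \sum_(i < n) psi i ^+ p
    - \sum_j b j * complex.Im (dg Q (adj m *m u) j)
    + - c * (n%:R - complex.Re (\tr (adj m *m u))) by lra.
by apply: h => j k; have := H j k; lra.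
Qed.

(** A bootstrap: the half-plane argument first puts the angles of m below pi/2, which suffices for
    convexity of F_p; convexity then improves them to at most [rho], which is what the quadratic
    gain requires. *)
Lemma midpoint_spow p rho u v P th : (1 < p)%N -> ~~ odd p ->
  unitary u -> unitary v -> 0 <= rho -> rho < pi / 2 ->
  spow p u <= rho ^+ p -> spow p v <= rho ^+ p ->
  angdec (adj u *m v) P th ->
  let m := u *m sdec P (fun j => expi (th j / 2)) in
  [/\ forall j, `|th j| < pi,
      2 * spow p m <= spow p u + spow p v &
      2 * spow 2 m + (1 - 2 * rho / pi) / 2 * frob (u - v)
        <= spow 2 u + spow 2 v].
Proof.
move=> p1 op uu vv rho0 rhopi su sv dP m; have p0 : (0 < p)%N by exact: ltnW.
have pi0 := @pi_gt0 R.
have small x Q psi : angdec x Q psi -> spow p x <= rho ^+ p ->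
    forall j, `|psi j| <= rho.
  move=> dx sx j; rewrite -(ler_pXn2r p0) ?nnegrE//.
  rewrite -normrX ger0_norm ?exprn_even_ge0//.
  exact: le_trans (angle_le_spow j op dx) sx.
have [Pu [thu du]] := unitary_angdec uu; have [Pv [thv dv]] := unitary_angdec vv.
have hu := small _ _ _ du su; have hv := small _ _ _ dv sv.
have hu' j : `|thu j| < pi / 2 := le_lt_trans (hu j) rhopi.
have hv' j : `|thv j| < pi / 2 := le_lt_trans (hv j) rhopi.
have thpi := half_plane_angle_lt du hu' dv hv' dP.
have PP : unitary P by case: dP.
set w := sdec P (fun j => expi (th j / 2)) in m *.
have ww : unitary w by apply: unitary_sdec => // j; exact: normsq_expi.
have mm : unitary m by exact: unitary_mul.
have [Q [psi dm]] := unitary_angdec mm.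
have hm' := midpoint_angle_lt du hu' dv hv' dP thpi dm.
have E : adj u *m v = sdec P (fun j => expi (th j)) by case: dP.
have wwE : adj u *m v = w *m w.
  rewrite E /w sdecM//; congr sdec; apply/funext => j.
  by rewrite -expiD; congr expi; field.
have mu : adj m *m u = adj w by rewrite /m adjM -mulmxA uu mulmx1.
have mv : adj m *m v = w by rewrite /m adjM -mulmxA wwE mulmxA ww mul1mx.
have sum0 (b : 'I_n -> R) : \sum_j b j * complex.Im (dg Q (adj w) j) =
    - \sum_j b j * complex.Im (dg Q w j).
  by rewrite -sumrN; apply: eq_bigr => j _; rewrite dg_adj Im_conjc mulrN.
have cvx : 2 * spow p m <= spow p u + spow p v.
  have T x S sg : angdec x S sg -> (forall j, `|sg j| < pi / 2) ->
      spow p m + \sum_j p%:R * psi j ^+ p.-1 * complex.Im (dg Q (adj m *m x) j)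
        <= spow p x.
    move=> dx hx; have := @spow_tangent p x m S sg Q psi
      (fun j => p%:R * psi j ^+ p.-1) 0 op dx dm.
    rewrite !mul0r addr0; apply => j k; rewrite mul0r addr0.
    by apply: tangent_exprn_ge => //; exact: ltW.
  have := T _ _ _ du hu'; have := T _ _ _ dv hv'; rewrite mu mv sum0; lra.
split => //.
have sm : spow p m <= rho ^+ p by move: cvx su sv; lra.
have hm := small _ _ _ dm sm.
pose kap := 1 - 2 * rho / pi.
have kap0 : 0 <= kap.
  by rewrite /kap subr_ge0 ler_pdivrMr// mul1r; lra.
have T x S sg : angdec x S sg -> (forall j, `|sg j| < pi / 2) ->
    spow 2 m + \sum_j 2 * psi j * complex.Im (dg Q (adj m *m x) j)
      + kap * frob (m - x) <= spow 2 x.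
  (* The coefficient 2 kap comes from d^2 >= 2 (1 - cos d). *)
  move=> dx hx; have := @spow_tangent 2 x m S sg Q psi
    (fun j => 2 * psi j) (2 * kap) isT dx dm.
  rewrite (mulrC 2 kap) mulfK ?pnatr_eq0//; apply => j k.
  have d1 : `|sg k - psi j| <= pi.
    apply: le_trans (ler_normB _ _) _.
    have := hx k; have := hm' j; lra.
  have := @tangent_sqr_ge R rho (psi j) (sg k) (hm j) d1.
  apply: le_trans; rewrite lerD2l -/kap -mulrA ler_wpM2l//.
  have := onem_cos_le (sg k - psi j); lra.
have := T _ _ _ du hu'; have := T _ _ _ dv hv'; rewrite mu mv sum0.
have fE x : unitary x -> adj m *m x = w \/ adj m *m x = adj w ->
    frob (m - x) = 2 * \sum_j (1 - cos (th j / 2)).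
  move=> xx [] hx; rewrite frobB_unitary// hx ?adj_sdec tr_sdec// Re_sum sumrB.
    by rewrite sumr_const card_ord.
  rewrite sumr_const card_ord; under eq_bigr do rewrite Re_conjc.
  by [].
have fu : frob (m - u) = 2 * \sum_j (1 - cos (th j / 2)) by apply: fE => //; right.
have fv : frob (m - v) = 2 * \sum_j (1 - cos (th j / 2)) by apply: fE => //; left.
(* The chord is at most twice the half chord: with x = cos (th/2), 1 - cos th = 2 (1 - x)(1 + x) <=
   4 (1 - x). Two gains kap F thus give at least (kap / 2) [frob (u - v)]. *)
have fuv : frob (u - v) <= 4 * (2 * \sum_j (1 - cos (th j / 2))).
  rewrite frobB_unitary// E tr_sdec// Re_sum mulrCA ler_wpM2l//.
  rewrite (_ : n%:R = \sum_(j < n) 1); last by rewrite sumr_const card_ord.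
  rewrite -sumrB mulr_sumr; apply: ler_sum => j _ /=.
  have -> : cos (th j) = 2 * cos (th j / 2) ^+ 2 - 1.
    have {1}-> : th j = (th j / 2) *+ 2 by rewrite -mulr_natr; field.
    by rewrite cos_mulr2n -mulr_natl.
  have := cos_le1 (th j / 2); have := cos_geN1 (th j / 2).
  by move: (cos _) => x; nra.
rewrite fu fv -/kap; move: fuv; set F := 2 * _ => fuv.
have := ler_wpM2l kap0 fuv; rewrite -/kap.
rewrite [kap / 2 * _]mulrAC [kap * (4 * F)]mulrCA.
move: (kap * frob (u - v)) (kap * F) => z y; lra.
Qed.

End Midpoint.

(** * Limits of Cauchy sequences in a closed set of matrices *)

Section Completeness.
Variable R : realType.
Local Notation C := R[i].

Lemma cvg_of_sqr_bound (x e : nat -> R) : e @ \oo --> (0 : R) ->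
  (forall k l, (k <= l)%N -> (x k - x l) ^+ 2 <= e k) ->
  exists2 x0 : R, x @ \oo --> x0 & forall k, (x k - x0) ^+ 2 <= e k.
Proof.
move=> e0 H; have cx : cvg (x @ \oo).
  apply/cauchy_cvgP/cauchy_exP => eps eps0.
  have eps2 : 0 < eps ^+ 2 by rewrite exprn_gt0.
  have /cvgrPdist_lt/(_ _ eps2)[k _ hk] := e0.
  exists (x k); exists k => // l /= kl.
  rewrite /ball/= -(ltr_pXn2r (n := 2))// ?nnegrE ?(ltW eps0)//.
  rewrite real_normK ?num_real//.
  apply: le_lt_trans (H k l kl) _.
  have := hk k (leqnn k); rewrite /= sub0r normrN; exact: le_lt_trans (ler_norm _).
exists (lim (x @ \oo)) => // k.
have c2 : (fun l => (x k - x l) * (x k - x l)) @ \oo -->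
    (x k - lim (x @ \oo)) * (x k - lim (x @ \oo)).
  by apply: cvgM; apply: cvgB => //; exact: cvg_cst.
apply: (cvgr_to_le c2); exists k => // l /= kl.
by rewrite -expr2 H.
Qed.

Lemma cvg_mx_entry (n : nat) (x : nat -> 'M[R]_n) (x0 : 'M[R]_n) :
  (forall i j, (fun k => x k i j) @ \oo --> x0 i j) -> x @ \oo --> x0.
Proof.
move=> H; apply/cvg_ballP => e e0.
have : \forall k \near \oo, forall i j, ball (x0 i j) e (x k i j).
  apply: filter_forall => i; apply: filter_forall => j.
  by move/cvg_ballP: (H i j); exact.
by apply: filterS => k h; split.
Qed.

(** Closedness is meant for pairs of real matrices, so limits are taken part by part. The constant
    counts n * n entries with two real parts each. *)
Lemma closed_realify_limit (n : nat) (M : set 'M[C]_n) (c : nat -> 'M[C]_n)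
    (e : nat -> R) : closed (realify @` M) -> (forall k, M (c k)) ->
  e @ \oo --> (0 : R) ->
  (forall k l, (k <= l)%N -> frob (c k - c l) <= e k) ->
  exists2 c0, M c0 & forall k, frob (c k - c0) <= (n * n)%:R * (2 * e k).
Proof.
move=> cM Mc e0 H.
have entry k l i j : (k <= l)%N -> normsq ((c k - c l) i j) <= e k.
  by move=> kl; apply: le_trans (normsq_le_frob _ _ _) (H _ _ kl).
have /choice[xr xrP] (ij : 'I_n * 'I_n) : exists x0 : R,
    (fun k => complex.Re (c k ij.1 ij.2)) @ \oo --> x0 /\
    forall k, (complex.Re (c k ij.1 ij.2) - x0) ^+ 2 <= e k.
  have [|x0 h1 h2] := @cvg_of_sqr_bound (fun k => complex.Re (c k ij.1 ij.2)) e e0.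
    move=> k l /(entry _ _ ij.1 ij.2); apply: le_trans.
    by rewrite /normsq !mxE Re_addc Re_oppc lerDl sqr_ge0.
  by exists x0.
have /choice[xi xiP] (ij : 'I_n * 'I_n) : exists x0 : R,
    (fun k => complex.Im (c k ij.1 ij.2)) @ \oo --> x0 /\
    forall k, (complex.Im (c k ij.1 ij.2) - x0) ^+ 2 <= e k.
  have [|x0 h1 h2] := @cvg_of_sqr_bound (fun k => complex.Im (c k ij.1 ij.2)) e e0.
    move=> k l /(entry _ _ ij.1 ij.2); apply: le_trans.
    by rewrite /normsq !mxE Im_addc Im_oppc lerDr sqr_ge0.
  by exists x0.
pose c0 : 'M[C]_n := \matrix_(i, j) Complex (xr (i, j)) (xi (i, j)).
exists c0.
  have : (realify @` M) (realify c0).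
    apply: (@closed_cvg _ _ \oo _ (fun k => realify (c k)) _ cM).
      by exists 0%N => // k _; exists (c k).
    have hr : (fun k => map_mx (@complex.Re R) (c k)) @ \oo -->
        map_mx (@complex.Re R) c0.
      apply: cvg_mx_entry => i j; have [h _] := xrP (i, j).
      have -> : map_mx (@complex.Re R) c0 i j = xr (i, j) by rewrite !mxE.
      by under eq_fun do rewrite mxE.
    have hi : (fun k => map_mx (@complex.Im R) (c k)) @ \oo -->
        map_mx (@complex.Im R) c0.
      apply: cvg_mx_entry => i j; have [h _] := xiP (i, j).
      have -> : map_mx (@complex.Im R) c0 i j = xi (i, j) by rewrite !mxE.
      by under eq_fun do rewrite mxE.
    exact: (cvg_pair hr hi).
  move=> [c1 Mc1 [/matrixP hr /matrixP hi]].
  suff -> : c0 = c1 by [].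
  apply/matrixP => i j; apply: complex_inj.
    by have := hr i j; rewrite !mxE.
  by have := hi i j; rewrite !mxE.
move=> k; rewrite /frob natrM -mulrA.
rewrite -[X in X * _](_ : \sum_(i < n) 1 = _ :> R); last first.
  by rewrite sumr_const card_ord.
rewrite mulr_suml; apply: ler_sum => i _; rewrite mul1r.
rewrite -[X in X * _](_ : \sum_(i < n) 1 = _ :> R); last first.
  by rewrite sumr_const card_ord.
rewrite mulr_suml; apply: ler_sum => j _; rewrite mul1r.
rewrite /normsq !mxE Re_addc Im_addc Re_oppc Im_oppc/=.
have [_ h1] := xrP (i, j); have [_ h2] := xiP (i, j).
by have := h1 k; have := h2 k; rewrite /=; lra.
Qed.

End Completeness.

(** * Almost-centers, existence and uniqueness of the circumcenter *)

Section Circumcenter.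
Variables (R : realType) (n p : nat) (eps : R).
Local Notation C := R[i].
Local Notation mx := 'M[C]_n.
Hypotheses (p1 : (1 < p)%N) (op : ~~ odd p) (eps0 : 0 < eps).
Implicit Types (a c u v : mx).

Let p0 : (0 < p)%N. Proof. exact: ltnW. Qed.

(** The p-th power of the distance from c to a; left translation by a^* moves the point a of A to
    the identity. *)
Definition dpow a c : R := spow p (adj a *m c) + eps ^+ p * spow 2 (adj a *m c).

Lemma dpow_ge0 a c : 0 <= dpow a c.
Proof. by rewrite addr_ge0 ?spow_ge0// mulr_ge0 ?spow_ge0// exprn_ge0// ltW. Qed.

Lemma d_pepsE a c : unitary a -> unitary c ->
  d_peps p eps c a = dpow a c `^ p%:R^-1.
Proof.
move=> aa cc; rewrite /d_peps !d_evenE// !rootK// ?spow_ge0//.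
have -> : adj c *m a = adj (adj a *m c) by rewrite adjM adjK.
have ac : unitary (adj a *m c) by apply: unitary_mul => //; exact: unitary_adj.
by rewrite !spow_adj.
Qed.

Lemma d_peps_le a c (r : R) : unitary a -> unitary c -> 0 <= r ->
  (d_peps p eps c a <= r) = (dpow a c <= r ^+ p).
Proof.
move=> aa cc r0; rewrite d_pepsE// -(ler_pXn2r p0) ?nnegrE ?powR_ge0//.
by rewrite rootK// dpow_ge0.
Qed.

Lemma frobB_mull a u v : unitary a -> unitary u -> unitary v ->
  frob (adj a *m u - adj a *m v) = frob (u - v).
Proof.
move=> aa uu vv; have aV := unitary_adj aa.
have au := unitary_mul aV uu; have av := unitary_mul aV vv.
rewrite !frobB_unitary// adjM adjK -mulmxA (mulmxA a) unitaryVr//.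
by rewrite mul1mx.
Qed.

(** The p-part contributes plain convexity and the eps-part the gain. [rho1] is kept apart from
    [rho] so that the gain constant stays fixed while [rho] tends to the radius; the 4 is the 2 of
    [midpoint_spow] after averaging. *)
Lemma dpow_midpoint a c1 c2 P th (rho rho1 : R) :
  unitary a -> unitary c1 -> unitary c2 ->
  0 <= rho -> rho <= rho1 -> rho1 < pi / 2 ->
  dpow a c1 <= rho ^+ p -> dpow a c2 <= rho ^+ p ->
  angdec (adj c1 *m c2) P th ->
  (forall j, `|th j| < pi) /\
  dpow a (c1 *m sdec P (fun j => expi (th j / 2)))
    + eps ^+ p * (1 - 2 * rho1 / pi) / 4 * frob (c1 - c2) <= rho ^+ p.
Proof.
move=> aa u1 u2 r0 r01 r1 D1 D2 dP; have aV := unitary_adj aa.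
have ep0 : 0 <= eps ^+ p by rewrite exprn_ge0// ltW.
have e1 : adj (adj a *m c1) *m (adj a *m c2) = adj c1 *m c2.
  by rewrite adjM adjK -mulmxA (mulmxA a) unitaryVr// mul1mx.
have s1 c : dpow a c <= rho ^+ p -> spow p (adj a *m c) <= rho1 ^+ p.
  move=> h; apply: le_trans (_ : rho ^+ p <= _); last first.
    by rewrite lerXn2r ?nnegrE// (le_trans r0).
  apply: le_trans h; rewrite /dpow lerDl mulr_ge0// spow_ge0//.
have := @midpoint_spow R n p rho1 (adj a *m c1) (adj a *m c2) P th p1 op
  (unitary_mul aV u1) (unitary_mul aV u2) (le_trans r0 r01) r1 (s1 _ D1) (s1 _ D2).
rewrite e1 frobB_mull// -mulmxA => /(_ dP)[thpi hp h2]; split => //.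
have h2' := ler_wpM2l ep0 h2.
move: D1 D2 h2'; rewrite /dpow; move: (1 - 2 * rho1 / pi) (frob _) => k f.
rewrite !mulrDr.
have -> : eps ^+ p * (k / 2 * f) = 2 * (eps ^+ p * k / 4 * f) by field.
rewrite (mulrCA _ 2); move: (eps ^+ p * k / 4 * f) => y.
move: (eps ^+ p * _) (eps ^+ p * _) (eps ^+ p * _) => x1 x2 x3.
move: hp; lra.
Qed.

Lemma geodesic_midpoint (M : set mx) c1 c2 P th : geodesic_subset M ->
  M c1 -> M c2 -> angdec (adj c1 *m c2) P th -> (forall j, `|th j| < pi) ->
  M (c1 *m sdec P (fun j => expi (th j / 2))).
Proof.
move=> [MU _ MG] M1 M2 dP thpi; have u1 := MU _ M1.
have PP : unitary P by case: dP.
have lg : is_log (invmx c1 *m c2) (sdec P (fun l => Complex 0 (th l))).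
  by rewrite invmx_unitary//; exact: angdec_is_log.
have := MG _ _ M1 M2 (d_inf_lt u1 dP thpi) _ lg 2^-1.
rewrite sdecZ.
have -> : (fun j => Complex 2^-1 0 * Complex 0 (th j)) =
    (fun j => Complex 0 (th j / 2)).
  by apply/funext => j; apply: complex_inj; rewrite ?Re_mulc ?Im_mulc/=; ring.
by rewrite expm_sdec//; apply; lra.
Qed.

Lemma dpow_lip : exists2 K : R, 0 <= K & forall a c c', unitary a -> unitary c ->
  unitary c' ->
  dpow a c' <= dpow a c + K * Num.sqrt (frob (c - c')) + K * frob (c - c').
Proof.
have [K1 K10 H1] := @spow_lip R n p op; have [K2 K20 H2] := @spow_lip R n 2 isT.
have ep0 : 0 <= eps ^+ p by rewrite exprn_ge0// ltW.
exists (K1 + eps ^+ p * K2) => [|a c c' aa cc cc'].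
  by rewrite addr_ge0// mulr_ge0.
have aV := unitary_adj aa.
have := H1 _ _ (unitary_mul aV cc) (unitary_mul aV cc').
have := ler_wpM2l ep0 (H2 _ _ (unitary_mul aV cc) (unitary_mul aV cc')).
rewrite frobB_mull// /dpow; move: (frob (c - c')) => f; move: (Num.sqrt f) => s.
rewrite !mulrDr !mulrDl !mulrA; lra.
Qed.

Section WithRadius.
Variables (M A : set mx) (r : R).
Hypotheses (GM : geodesic_subset M) (cM : closed (realify @` M))
  (AM : A `<=` M) (A0 : A !=set0) (rE : mradius (d_peps p eps) M A = r%:E)
  (r0 : 0 <= r) (rpi : r < pi / 2).

Let MU c : M c -> unitary c. Proof. by case: GM => + _ _; exact. Qed.

Lemma radius_le c (rho : R) : M c -> (forall a, A a -> d_peps p eps c a <= rho) ->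
  r <= rho.
Proof.
move=> Mc H; rewrite -lee_fin -rE; apply: ereal_inf_lbound.
by exists rho => //; exists c.
Qed.

Lemma near_center (e : R) : 0 < e ->
  exists2 c, M c & forall a, A a -> d_peps p eps c a <= r + e.
Proof.
move=> e0; have : (mradius (d_peps p eps) M A < (r + e)%:E)%E.
  by rewrite rE lte_fin ltrDl.
move=> /ereal_inf_lt[_ [s [c [Mc H]] <-]]; rewrite lte_fin => /ltW se.
by exists c => // a /H h; exact: le_trans h se.
Qed.

(** Halfway between r and pi/2: room above the radius for almost-centers, and still below pi/2, so
    that [kap] is positive. *)
Let rho1 := (r + pi / 2) / 2.
Let kap : R := eps ^+ p * (1 - 2 * rho1 / pi) / 4.

Let rho1_gt : r < rho1. Proof. by move: rpi; rewrite /rho1; lra. Qed.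
Let rho1_lt : rho1 < pi / 2. Proof. by move: rpi; rewrite /rho1; lra. Qed.

Let kap_gt0 : 0 < kap.
Proof.
have pi0 := @pi_gt0 R; have h := rho1_lt.
rewrite /kap divr_gt0// mulr_gt0// ?exprn_gt0// subr_gt0 ltr_pdivrMr// mul1r.
by move: h; lra.
Qed.

(** The midpoint lies in M and sees all of A within the p-th root of rho^p - kap [frob (c1 - c2)].
    By definition of the radius this root is at least r. *)
Lemma center_separation c1 c2 (rho : R) : M c1 -> M c2 -> 0 <= rho -> rho <= rho1 ->
  (forall a, A a -> d_peps p eps c1 a <= rho) ->
  (forall a, A a -> d_peps p eps c2 a <= rho) ->
  frob (c1 - c2) <= (rho ^+ p - r ^+ p) / kap.
Proof.
move=> M1 M2 rho0 rhorho1 H1 H2; have u1 := MU M1; have u2 := MU M2.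
have [P [th dP]] := unitary_angdec (unitary_mul (unitary_adj u1) u2).
have mid a : A a -> (forall j, `|th j| < pi) /\
    dpow a (c1 *m sdec P (fun j => expi (th j / 2))) + kap * frob (c1 - c2)
      <= rho ^+ p.
  move=> Aa; have ua := MU (AM Aa).
  by apply: dpow_midpoint => //; rewrite -d_peps_le ?H1 ?H2.
have [a0 Aa0] := A0; have [thpi h0] := mid a0 Aa0.
have Mm := geodesic_midpoint GM M1 M2 dP thpi.
set m := c1 *m _ in Mm h0 mid.
have X0 : 0 <= rho ^+ p - kap * frob (c1 - c2).
  by have := dpow_ge0 a0 m; move: h0; lra.
rewrite ler_pdivlMr// mulrC lerBrDl -lerBrDr.
rewrite -[leRHS](rootK p0 X0) lerXn2r ?nnegrE ?powR_ge0//.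
apply: (@radius_le m) => // a Aa; have [_ h] := mid a Aa.
have ua := MU (AM Aa); have um := MU Mm.
by rewrite d_peps_le ?powR_ge0// rootK//; move: h; lra.
Qed.

(** The other inequality is automatic: a finite supremum of distances is itself an admissible
    radius, hence at least r, and a point of A excludes the value -oo. *)
Lemma circumcenterP c : circumcenter (d_peps p eps) M A c <->
  M c /\ forall a, A a -> d_peps p eps c a <= r.
Proof.
rewrite /circumcenter rE; split => [[Mc sE]|[Mc H]]; split => //.
  by move=> a Aa; rewrite -lee_fin -sE; apply: ereal_sup_ubound; exists a.
apply/eqP; rewrite eq_le; apply/andP; split.
  by apply: ge_ereal_sup => _ [a Aa <-]; rewrite lee_fin H.
have [a0 Aa0] := A0.
have lb a : A a ->
    ((d_peps p eps c a)%:E <= ereal_sup [set (d_peps p eps c a)%:E | a in A])%E.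
  by move=> Aa; apply: ereal_sup_ubound; exists a.
case E : (ereal_sup _) lb => [s| |] lb.
- rewrite lee_fin; apply: (@radius_le c) => //.
- exact: leey.
- by have := lb a0 Aa0.
Qed.

Lemma circumcenter_exists : exists c, M c /\ forall a, A a -> d_peps p eps c a <= r.
Proof.
(* Starts at [rho1], since [harmonic 0 = 1], and decreases to r, so [center_separation] applies to
   every pair of terms. *)
pose rho k : R := r + (rho1 - r) * harmonic k.
have d0 : 0 < rho1 - r by rewrite subr_gt0.
have h01 k : 0 < (harmonic k : R) <= 1.
  by rewrite /harmonic/= invr_gt0 ltr0n/= invf_le1 ?ltr0n// ler1n.
have rho_gt k : r < rho k.
  by rewrite ltrDl mulr_gt0//; case/andP: (h01 k).
have rho_le k : rho k <= rho1.
  rewrite /rho -lerBrDl ler_piMr ?(ltW d0)//; by case/andP: (h01 k).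
have rho_mono k l : (k <= l)%N -> rho l <= rho k.
  move=> kl; rewrite /rho lerD2l ler_wpM2l ?(ltW d0)//.
  by rewrite /harmonic/= lef_pV2 ?posrE ?ltr0n// ler_nat.
have rho_cvg : rho @ \oo --> r.
  rewrite -[X in _ --> X]addr0 -[X in _ --> _ + X](mulr0 (rho1 - r)).
  by apply: cvgD; [exact: cvg_cst|apply: cvgM; [exact: cvg_cst|exact: cvg_harmonic]].
have rhop_cvg : (fun k => rho k ^+ p) @ \oo --> r ^+ p.
  exact: (continuous_cvg _ (@exprn_continuous R p r) rho_cvg).
have /choice[c cP] k : exists c, M c /\ forall a, A a -> d_peps p eps c a <= rho k.
  have [|c Mc H] := @near_center (rho k - r); first by rewrite subr_gt0.
  by exists c; split => // a /H; rewrite addrC subrK.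
have Mc k : M (c k) by case: (cP k).
pose e k : R := (rho k ^+ p - r ^+ p) / kap.
have e_cvg : e @ \oo --> (0 : R).
  rewrite -(mul0r kap^-1) -(subrr (r ^+ p)).
  by apply: cvgM; [apply: cvgB => //|]; exact: cvg_cst.
have sep k l : (k <= l)%N -> frob (c k - c l) <= e k.
  move=> kl; apply: center_separation => //.
  - by rewrite (le_trans r0)// ltW.
  - by case: (cP k).
  - by move=> a Aa; case: (cP l) => _ H; apply: le_trans (H a Aa) (rho_mono _ _ kl).
have [c0 Mc0 fc0] := closed_realify_limit cM Mc e_cvg sep.
exists c0; split => // a Aa; have ua := MU (AM Aa); have uc0 := MU Mc0.
rewrite d_peps_le//.
have [K K0 HK] := dpow_lip.
pose E k := (n * n)%:R * (2 * e k).
have E_cvg : E @ \oo --> (0 : R).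
  rewrite -(mulr0 (n * n)%:R) -[X in _ * X](mulr0 2).
  apply: cvgM; first exact: cvg_cst.
  by apply: cvgM => //; exact: cvg_cst.
have sE_cvg : (fun k => Num.sqrt (E k)) @ \oo --> (0 : R).
  rewrite -[X in _ --> X](@sqrtr0 R).
  exact: (continuous_cvg _ (@sqrt_continuous R 0) E_cvg).
have lim_cvg : (fun k => rho k ^+ p + K * Num.sqrt (E k) + K * E k) @ \oo --> r ^+ p.
  rewrite -[X in _ --> X]addr0 -[X in _ --> X + _]addr0 -{1 2}(mulr0 K).
  apply: cvgD; first apply: cvgD => //.
    by apply: cvgM => //; exact: cvg_cst.
  by apply: cvgM => //; exact: cvg_cst.
(* For fixed a, the bound on [dpow a (c k)] is carried over to the limit [c0] by [dpow_lip], with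
   [E k] bounding the squared distance. *)
apply: (cvgr_to_ge lim_cvg); exists 0%N => // k _ /=.
apply: le_trans (HK a (c k) c0 ua (MU (Mc k)) uc0) _.
apply: lerD; first apply: lerD.
- rewrite -d_peps_le//; last 2 first.
  + exact: MU.
  + by rewrite (le_trans r0)// ltW.
  by case: (cP k) => _; exact.
- by rewrite ler_wpM2l// ler_wsqrtr// fc0.
- by rewrite ler_wpM2l// fc0.
Qed.

Lemma circumcenter_unique c1 c2 : M c1 -> M c2 ->
  (forall a, A a -> d_peps p eps c1 a <= r) ->
  (forall a, A a -> d_peps p eps c2 a <= r) -> c1 = c2.
Proof.
move=> M1 M2 H1 H2.
have := center_separation M1 M2 r0 (ltW rho1_gt) H1 H2.
rewrite subrr mul0r => f0; apply/matrixP => i j.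
have : normsq ((c1 - c2) i j) <= 0 by apply: le_trans f0; exact: normsq_le_frob.
rewrite /normsq !mxE Re_addc Im_addc Re_oppc Im_oppc => h.
apply: complex_inj; apply/eqP; rewrite -subr_eq0 -sqrf_eq0 eq_le sqr_ge0 andbT;
  apply: le_trans h; by rewrite ?lerDl ?lerDr sqr_ge0.
Qed.

End WithRadius.

End Circumcenter.

Theorem theorem4p12 (R : realType) (n p : nat) (eps : R)
    (M A : set 'M[R[i]]_n) :
  (2 <= p)%N -> ~~ odd p -> 0 < eps ->
  geodesic_subset M -> closed (realify @` M) ->
  A `<=` M -> A !=set0 ->
  (mradius (d_peps p eps) M A < (pi / 2)%:E)%E ->
  exists! c, circumcenter (d_peps p eps) M A c.
Proof.
move=> p1 op eps0 GM cM AM A0 rad.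
(* The radius is an extended real; a point of A keeps it from being -oo, the value obtained when A
   is empty and every real is admissible. *)
have [r [r0 rE]] : exists r : R, 0 <= r /\ mradius (d_peps p eps) M A = r%:E.
  have h0 : (0%:E <= mradius (d_peps p eps) M A)%E.
    apply: le_ereal_inf_tmp => _ [s [c [_ H]] <-]; rewrite lee_fin.
    by have [a Aa] := A0; apply: le_trans (H a Aa); exact: powR_ge0.
  case E : (mradius _ _ _) h0 rad => [r| |]; rewrite ?lee_fin //.
  by exists r.
have rpi : r < pi / 2 by rewrite -lte_fin -rE.
have cP c := circumcenterP A0 rE c.
have [c [Mc Hc]] := circumcenter_exists p1 op eps0 GM cM AM A0 rE r0 rpi.
exists c; split; first exact/cP.
move=> c' /cP[Mc' Hc'].
exact: (circumcenter_unique p1 op eps0 GM AM A0 rE r0 rpi).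
Qed.
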